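(* Let $p$ be a prime and let $K$ be a field of characteristic $p$ admitting a valuation $v$ whose value group $\Gamma_v$ is not $p$-divisible (i.e. $p\Gamma_v\neq\Gamma_v$). Then every finite $p$-embedding problem for $K$ is properly solvable.
   Context: A valuation of a field $K$ is a map $v$ from $K$ onto $\Gamma_v\cup\{\infty\}$, where $\Gamma_v$ is a totally ordered commutative group (written additively; called the value group) and $\infty$ is an extra element with $\alpha+\infty=\infty$ and $\alpha<\infty$ for all $\alpha\in\Gamma_v$, such that $v(x)=\infty$ iff $x=0$, $v(xy)=v(x)+v(y)$, and $v(x+y)\ge\min\{v(x),v(y)\}$ for all $x,y\in K$. All homomorphisms of profinite groups are assumed continuous. An embedding problem for a profinite group $\Pi$ consists of profinite groups $\Gamma$, $G$ and epimorphisms $\alpha:\Pi\to G$ and $f:\Gamma\to G$. It is finite if $\Gamma$ is finite, and it is a $p$-embedding problem if its kernel $\ker(f)$ is a $p$-group. A proper solution is a surjective homomorphism $\beta:\Pi\to\Gamma$ with $f\circ\beta=\alpha$; the problem is properly solvable if a proper solution exists. An embedding problem for a field $K$ is an embedding problem for its absolute Galois group $\mathrm{Gal}(K)=\mathrm{Gal}(K_{\mathrm{sep}}/K)$. *)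

(* Defs.v *)
From HB Require Import structures.
From mathcomp Require Import all_boot all_order all_algebra all_field.
From mathcomp Require Import boolp classical_sets functions cardinality filter.
From mathcomp Require Import topology.

Set Implicit Arguments.
Unset Strict Implicit.
Unset Printing Implicit Defensive.
Set SsrOldRewriteGoalsOrder.

Import Order.TTheory GRing.Theory Num.Theory.

Local Open Scope classical_set_scope.
Local Open Scope ring_scope.

HB.mixin Record POrderedZmodule_isOrderedAbelianGroup G
    & Num.POrderedZmodule G := {
  oag_total : total (<=%R : rel G);
  oag_le_add : forall c a b : G, a <= b -> c + a <= c + b
}.

#[short(type="orderedAbelianGroup")]
HB.structure Definition OrderedAbelianGroup :=
  { G of Num.POrderedZmodule G & POrderedZmodule_isOrderedAbelianGroup G }.

(* [Some a] is the element a of the group and [None] is infinity. *)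
Definition with_infty (G : Type) : Type := option G.

Section WithInfty.
Variable G : orderedAbelianGroup.

Definition infty : with_infty G := None.

Definition vadd (a b : with_infty G) : with_infty G :=
  match a, b with
  | Some a, Some b => Some (a + b)
  | _, _ => infty
  end.

Definition vle (a b : with_infty G) : bool :=
  match a, b with
  | _, None => true
  | None, Some _ => false
  | Some a, Some b => a <= b
  end.

Definition vmin (a b : with_infty G) : with_infty G :=
  if vle a b then a else b.

End WithInfty.

Record valuation (K : fieldType) (G : orderedAbelianGroup) := Valuation {
  val_fun :> K -> with_infty G;
  val_onto : forall a : with_infty G, exists x : K, val_fun x = a;
  val_infty : forall x : K, val_fun x = infty G <-> x = 0;
  valM : forall x y : K, val_fun (x * y) = vadd (val_fun x) (val_fun y);
  valD : forall x y : K,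
    vle (vmin (val_fun x) (val_fun y)) (val_fun (x + y))
}.

Definition divisible_by (p : nat) (G : zmodType) : Prop :=
  range (fun a : G => a *+ p) = [set: G].

HB.structure Definition PreTopologicalGroup :=
  { G of Topological G & Group G }.

HB.mixin Record PreTopologicalGroup_isTopologicalGroup G
    & PreTopologicalGroup G := {
  mulg_continuous : continuous (fun x : G * G => (x.1 * x.2)%g);
  invg_continuous : continuous (fun x : G => (x^-1)%g)
}.

#[short(type="topologicalGroupType")]
HB.structure Definition TopologicalGroup :=
  { G of PreTopologicalGroup G & PreTopologicalGroup_isTopologicalGroup G }.

HB.mixin Record TopologicalGroup_isProfinite G & TopologicalGroup G := {
  profinite_compact : compact [set: G];
  profinite_hausdorff : hausdorff_space G;
  profinite_disconnected : totally_disconnected [set: G]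
}.

#[short(type="profiniteGroupType")]
HB.structure Definition ProfiniteGroup :=
  { G of TopologicalGroup G & TopologicalGroup_isProfinite G }.

Definition epimorphism (G H : profiniteGroupType)
    (f : {multiplicative G -> H}) : Prop :=
  continuous (f : G -> H) /\ range f = [set: H].

Record embedding_problem (Pi : profiniteGroupType) := EmbeddingProblem {
  ep_Gamma : profiniteGroupType;
  ep_G : profiniteGroupType;
  ep_alpha : {multiplicative Pi -> ep_G};
  ep_alpha_epi : epimorphism ep_alpha;
  ep_f : {multiplicative ep_Gamma -> ep_G};
  ep_f_epi : epimorphism ep_f
}.

Definition kernel (G H : profiniteGroupType) (f : {multiplicative G -> H}) :
  set G := [set x | f x = 1%g].

Definition p_group (p : nat) (G : groupType) (A : set G) : Prop :=
  forall x, A x -> exists n, (x ^+ (p ^ n)%N = 1)%g.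

Section EmbeddingProblem.
Variables (Pi : profiniteGroupType) (E : embedding_problem Pi).

Definition finite_embedding_problem : Prop :=
  finite_set [set: ep_Gamma E].

Definition p_embedding_problem (p : nat) : Prop :=
  p_group p (kernel (ep_f E)).

Definition proper_solution (beta : {multiplicative Pi -> ep_Gamma E}) : Prop :=
  epimorphism beta /\ ep_f E \o beta =1 ep_alpha E.

Definition properly_solvable : Prop :=
  exists beta : {multiplicative Pi -> ep_Gamma E}, proper_solution beta.

End EmbeddingProblem.

(* q is the minimal polynomial of x over K. *)
Definition separable_over (K L : fieldType) (iota : {rmorphism K -> L})
    (x : L) : Prop :=
  exists q : {poly K}, [/\ q \is monic, irreducible_poly q,
    root (map_poly iota q) x & separable_poly q].

Definition separably_closed (L : fieldType) : Prop :=
  forall q : {poly L}, separable_poly q -> (1 < size q)%N ->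
    exists x, root q x.

Record separable_closure (K : fieldType) := SeparableClosure {
  sc_field :> fieldType;
  sc_inj : {rmorphism K -> sc_field};
  sc_separable : forall x : sc_field, separable_over sc_inj x;
  sc_closed : separably_closed sc_field
}.

Section AbsoluteGaloisGroup.
Variables (K : fieldType) (Ksep : separable_closure K).
Local Notation iota := (sc_inj Ksep).

Definition automorphism_over (s : Ksep -> Ksep) : Prop :=
  [/\ zmod_morphism s, GRing.monoid_morphism s, bijective s
    & forall a : K, s (iota a) = iota a].

Record gal := Gal {
  gal_fun :> Ksep -> Ksep;
  gal_funP : `[< automorphism_over gal_fun >]
}.

HB.instance Definition _ := [isSub for gal_fun].
HB.instance Definition _ := [Choice of gal by <:].

Lemma gal_auto (s : gal) : automorphism_over s.
Proof. exact/asboolP/gal_funP. Qed.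

Definition mk_gal (s : Ksep -> Ksep) (sP : automorphism_over s) : gal :=
  Gal (introT (asboolP _) sP).

Lemma galP (s t : gal) : s =1 t -> s = t.
Proof. by move=> st; apply/val_inj/funext. Qed.

Lemma gal_zmod_morphism (s : gal) : zmod_morphism s.
Proof. by case: (gal_auto s). Qed.

Lemma gal_monoid_morphism (s : gal) : GRing.monoid_morphism s.
Proof. by case: (gal_auto s). Qed.

HB.instance Definition _ (s : gal) :=
  GRing.isZmodMorphism.Build Ksep Ksep s (gal_zmod_morphism s).
HB.instance Definition _ (s : gal) :=
  GRing.isMonoidMorphism.Build Ksep Ksep s (gal_monoid_morphism s).

Lemma gal_fix (s : gal) (a : K) : s (iota a) = iota a.
Proof. by case: (gal_auto s). Qed.

Lemma gal_one_subproof : automorphism_over id.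
Proof. by split=> //; exists id. Qed.
Definition gal_one : gal := mk_gal gal_one_subproof.

Lemma gal_mul_subproof (s t : gal) : automorphism_over (s \o t).
Proof.
split=> [x y|||a] /=; first by rewrite !raddfB.
- by split=> [|x y] /=; rewrite ?rmorph1 // !rmorphM.
- by apply: bij_comp; [case: (gal_auto s)|case: (gal_auto t)].
- by rewrite !gal_fix.
Qed.
Definition gal_mul (s t : gal) : gal := mk_gal (gal_mul_subproof s t).

Lemma gal_inv_ex (s : gal) : exists t : gal, cancel s t /\ cancel t s.
Proof.
case: (gal_auto s) => _ _ [t st ts] fixs.
suff tP : automorphism_over t by exists (mk_gal tP).
split=> [x y|||a].
- by apply: (can_inj st); rewrite raddfB /= !ts.
- by split=> [|x y]; apply: (can_inj st); rewrite ?rmorph1 ?rmorphM /= ?ts.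
- by exists s.
- by rewrite -{1}(fixs a) st.
Qed.
Definition gal_inv (s : gal) : gal := projT1 (cid (gal_inv_ex s)).

Lemma gal_invK (s : gal) : cancel s (gal_inv s).
Proof. by case: (projT2 (cid (gal_inv_ex s))). Qed.

Lemma gal_Kinv (s : gal) : cancel (gal_inv s) s.
Proof. by case: (projT2 (cid (gal_inv_ex s))). Qed.

Lemma gal_mulA : associative gal_mul. Proof. by move=> s t u; exact: galP. Qed.
Lemma gal_mul1g : left_id gal_one gal_mul. Proof. by move=> s; exact: galP. Qed.
Lemma gal_mulg1 : right_id gal_one gal_mul. Proof. by move=> s; exact: galP. Qed.
Lemma gal_mulVg : left_inverse gal_one gal_inv gal_mul.
Proof. by move=> s; apply: galP => x /=; rewrite gal_invK. Qed.
Lemma gal_mulgV : right_inverse gal_one gal_inv gal_mul.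
Proof. by move=> s; apply: galP => x /=; rewrite gal_Kinv. Qed.

HB.instance Definition _ :=
  isGroup.Build gal gal_mulA gal_mul1g gal_mulg1 gal_mulVg gal_mulgV.

Lemma galM (s t : gal) (x : Ksep) : (s * t)%g x = s (t x).
Proof. by []. Qed.

(* The Krull topology. Elements of the Galois group agree on a finite list r
   if and only if they agree on K(r), and the fields K(r) are exactly the finite
   subextensions of Ksep / K; hence the sets below are the cosets s Gal(Ksep/N)
   with N / K finite. *)
Definition krull_basic (s : gal) (r : seq Ksep) : set gal :=
  [set t : gal | {in r, s =1 t}].

Definition krull_nbhs (s : gal) : set_system gal :=
  filter_from [set: seq Ksep] (krull_basic s).

HB.instance Definition _ := hasNbhs.Build gal krull_nbhs.

Lemma krull_nbhs_filter (s : gal) : ProperFilter (nbhs s).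
Proof.
apply: filter_from_proper => [|r _]; last by exists s.
apply: filter_from_filter => [|r1 r2 _ _]; first by exists [::].
exists (r1 ++ r2) => // t st; split=> x rx; apply: st;
  by rewrite mem_cat rx ?orbT.
Qed.

Lemma krull_nbhs_singleton (s : gal) (A : set gal) : nbhs s A -> A s.
Proof. by move=> [r _]; apply. Qed.

Lemma krull_nbhs_nbhs (s : gal) (A : set gal) :
  nbhs s A -> nbhs s (nbhs^~ A).
Proof.
move=> [r _ rA]; exists r => // t st; exists r => // u tu.
by apply: rA => x rx; rewrite st // tu.
Qed.

HB.instance Definition _ := Nbhs_isNbhsTopological.Build gal
  krull_nbhs_filter krull_nbhs_singleton krull_nbhs_nbhs.

Lemma nbhs_krull_basic (s : gal) (r : seq Ksep) : nbhs s (krull_basic s r).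
Proof. by exists r. Qed.

Lemma gal_mul_continuous : continuous (fun x : gal * gal => (x.1 * x.2)%g).
Proof.
move=> [s t] A /= [r _ rA].
exists (krull_basic s (map t r), krull_basic t r).
  by split; exact: nbhs_krull_basic.
move=> [s' t'] [/= ss' tt']; apply: rA => x rx.
by rewrite !galM -tt' // ss' // map_f.
Qed.

Lemma gal_inv_continuous : continuous (fun s : gal => (s^-1)%g).
Proof.
move=> s A /= [r _ rA]; exists (map (gal_inv s) r) => // t st.
apply: rA => x rx; apply: (can_inj (gal_invK t)).
by rewrite gal_Kinv -st ?map_f // gal_Kinv.
Qed.

HB.instance Definition _ := PreTopologicalGroup_isTopologicalGroup.Build gal
  gal_mul_continuous gal_inv_continuous.

Lemma roots_finite (L : fieldType) (q : {poly L}) : q != 0 ->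
  exists r : seq L, forall x, root q x -> x \in r.
Proof.
have [n] := ubnP (size q); elim: n q => // n IHn q /ltnSE szq q0.
have [[a qa]|noroot] := pselect (exists a, root q a); last first.
  by exists [::] => x qx; case: noroot; exists x.
have /factor_theorem[q' defq] := qa.
have q'0 : q' != 0 by apply: contra_neq q0 => q'0; rewrite defq q'0 mul0r.
have [|r rP] := IHn q' _ q'0.
  by move: szq; rewrite defq size_Mmonic ?monicXsubC // size_XsubC addn2.
exists (a :: r) => x; rewrite defq rootM root_XsubC inE orbC.
by case/predU1P => [->|/rP->]; rewrite ?eqxx ?orbT.
Qed.

Lemma gal_conjugates (x : Ksep) :
  exists r : seq Ksep, forall s : gal, s x \in r.
Proof.
have [q [qmon _ qx _]] := sc_separable x.
have q0 : map_poly iota q != 0 by rewrite map_poly_eq0 monic_neq0.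
have [r rP] := roots_finite q0.
exists r => s; apply: rP; move: qx; rewrite /root => /eqP qx.
have -> : map_poly iota q = map_poly s (map_poly iota q).
  by apply/polyP => i; rewrite !coef_map /= gal_fix.
by rewrite horner_map qx rmorph0.
Qed.

Lemma gal_ultra_value (F : set_system gal) (g : gal -> gal) (x : Ksep) :
  UltraFilter F -> exists y, F [set s : gal | g s x = y].
Proof.
move=> FU; apply: contrapT => /forallNP noy.
have [r rP] := gal_conjugates x.
have /filter_ex[s /= /negP[]] : F [set s : gal | g s x \notin r]; last exact: rP.
elim: r {rP} => [|y r IHr]; first by apply: filterS filterT.
have [/noy//|Fy] := in_ultra_setVsetC [set s : gal | g s x = y] FU.
by apply: filterS2 Fy IHr => s /= /eqP sy sr; rewrite inE negb_or sy.
Qed.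

Lemma gal_compact : compact [set: gal].
Proof.
rewrite compact_ultra => F FU _.
have /choice[t tP] x := gal_ultra_value id x FU.
have /choice[u uP] x := gal_ultra_value gal_inv x FU.
suff tauto : automorphism_over t.
  exists (mk_gal tauto); split=> // A [r _ rA]; apply: filterS rA _.
  rewrite /krull_basic /=.
  elim: r => [|x r IHr]; first by apply: filterS filterT.
  apply: filterS2 (tP x) IHr => s /= sx sr y.
  by rewrite inE => /predU1P[->//|/sr].
split=> [x y|||a].
- near F => s; rewrite -(near (tP x) s) // -(near (tP y) s) //.
  by rewrite -(near (tP (x - y)) s) // raddfB.
- split=> [|x y].
    by have /filter_ex[s /= <-] := tP 1; rewrite rmorph1.
  near F => s; rewrite -(near (tP x) s) // -(near (tP y) s) //.
  by rewrite -(near (tP (x * y)) s) // rmorphM.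
- exists u => x.
    near F => s; rewrite -(near (uP (t x)) s) // -(near (tP x) s) //.
    by rewrite gal_invK.
  near F => s; rewrite -(near (tP (u x)) s) // -(near (uP x) s) //.
  by rewrite gal_Kinv.
- by have /filter_ex[s /= <-] := tP (iota a); rewrite gal_fix.
Unshelve. all: by end_near. Qed.

Lemma gal_separated (s t : gal) : s != t -> exists x, s x != t x.
Proof.
move=> st; apply: contrapT => /forallNP eqst; case/eqP: st; apply: galP => x.
by apply/eqP; apply: contrapT => /negP/eqst.
Qed.

Lemma krull_basic_open (s : gal) (r : seq Ksep) : open (krull_basic s r).
Proof.
rewrite openE => t st; exists r => // u tu x rx.
by rewrite st // tu.
Qed.

Lemma krull_basic_closed (s : gal) (r : seq Ksep) : closed (krull_basic s r).
Proof.
move=> t /(_ _ (nbhs_krull_basic t r))[u [su tu]] x rx.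
by rewrite su // tu.
Qed.

Lemma gal_zero_dimensional : zero_dimensional gal.
Proof.
move=> s t /gal_separated[x sx]; exists (krull_basic s [:: x]); split.
- by split; [exact: krull_basic_open|exact: krull_basic_closed].
- by [].
- by move/(_ x (mem_head _ _))/eqP; apply/negP.
Qed.

Lemma gal_hausdorff : hausdorff_space gal.
Proof.
move=> s t clst; apply: galP => x.
have [u [su tu]] :=
  clst _ _ (nbhs_krull_basic s [:: x]) (nbhs_krull_basic t [:: x]).
by rewrite su ?mem_head // tu ?mem_head.
Qed.

HB.instance Definition _ := TopologicalGroup_isProfinite.Build gal
  gal_compact gal_hausdorff
  (zero_dimension_totally_disconnected gal_zero_dimensional).

End AbsoluteGaloisGroup.

Definition absolute_galois_group (K : fieldType) (Ksep : separable_closure K) :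
  profiniteGroupType := gal Ksep.

(* Main.v *)
(* Filtering by a minimal normal subgroup M of Gamma inside the kernel, one may
   assume that the kernel is M, an irreducible F_p-module for the quotient. By
   Dedekind independence M embeds equivariantly in the additive group of Ksep,
   as the set of roots of a monic additive polynomial f over K, of degree |M|.
   The factor set of the extension, now with values in Ksep, splits by means of
   an element theta of trace one; Hilbert 90, again by means of theta, then
   yields an element a such that every root y of f(y) = a + k, with k in K,
   gives a lift of the form s |-> (s y - y + e s) * w s. By irreducibility this
   lift is onto unless y lies in a fixed finite Galois extension N of K. If that
   happened for all k, then by pigeonhole f(K) would have finite index in K; but
   f(x) has value |M| v(x) as soon as v(x) is very negative, so elements of
   distinct, very negative values outside p Gamma_v are incongruent mod f(K). *)
From HB Require Import structures.
Require Import Defs.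
From mathcomp Require Import all_boot all_order all_algebra separable ring.
From mathcomp Require Import all_fingroup all_solvable mxabelem.
From mathcomp Require Import boolp classical_sets functions cardinality filter.
From mathcomp Require Import topology.

Set Implicit Arguments.
Unset Strict Implicit.
Unset Printing Implicit Defensive.
Set SsrOldRewriteGoalsOrder.

Import Order.TTheory GRing.Theory.

Local Open Scope group_scope.
Local Open Scope ring_scope.

(** * Automorphisms of the separable closure *)

Section FixedField.
Local Open Scope classical_set_scope.
Local Open Scope ring_scope.
Variables (K : fieldType) (Ksep : separable_closure K).
Local Notation iota := (sc_inj Ksep).

(* Partial K-homomorphisms from Ksep to Ksep are handled through their graphs,
   which are subrings of Ksep * Ksep. *)
Record partial_hom (X : set (Ksep * Ksep)) : Prop := PartialHom {
  phom_base : forall a, X (iota a, iota a);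
  phom_sub : forall x y x' y', X (x, x') -> X (y, y') -> X (x - y, x' - y');
  phom_mul : forall x y x' y', X (x, x') -> X (y, y') -> X (x * y, x' * y');
  phom_fun : forall y, X (0, y) -> y = 0
}.

Definition poly_graph (X : set (Ksep * Ksep)) (g g' : {poly Ksep}) :=
  forall i, X (g`_i, g'`_i).

Section PartialHom.
Variables (X : set (Ksep * Ksep)) (homX : partial_hom X).

Lemma phom0 : X (0, 0).
Proof. by have := phom_base homX 0; rewrite rmorph0. Qed.

Lemma phom_add x y x' y' : X (x, x') -> X (y, y') -> X (x + y, x' + y').
Proof.
move=> Xx Xy; rewrite -[y]opprK -[y']opprK -[- y]sub0r -[- y']sub0r.
by apply: phom_sub => //; apply: phom_sub => //; apply: phom0.
Qed.

Lemma phom_sum (n : nat) (F F' : 'I_n -> Ksep) :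
  (forall i, X (F i, F' i)) -> X (\sum_i F i, \sum_i F' i).
Proof.
move=> FF'; pose P x y := X (x, y).
by apply: (big_ind2 P); [exact: phom0 | move=> *; exact: phom_add | move=> i _;
  apply: FF'].
Qed.

Lemma phom_exp x x' n : X (x, x') -> X (x ^+ n, x' ^+ n).
Proof.
move=> Xx; elim: n => [|n IHn]; last by rewrite !exprS; apply: phom_mul.
by have := phom_base homX 1; rewrite rmorph1.
Qed.

Lemma phom_funE x y y' : X (x, y) -> X (x, y') -> y = y'.
Proof.
move=> Xy Xy'; apply/eqP; rewrite -subr_eq0; apply/eqP/(phom_fun homX).
by rewrite -(subrr x); apply: phom_sub.
Qed.

Lemma pgraph_base (p : {poly K}) :
  poly_graph X (map_poly iota p) (map_poly iota p).
Proof. by move=> i; rewrite coef_map; apply: phom_base. Qed.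

Lemma pgraph_sub g h g' h' :
  poly_graph X g g' -> poly_graph X h h' -> poly_graph X (g - h) (g' - h').
Proof. by move=> gX hX i; rewrite !coefB; apply: phom_sub. Qed.

Lemma pgraph_add g h g' h' :
  poly_graph X g g' -> poly_graph X h h' -> poly_graph X (g + h) (g' + h').
Proof. by move=> gX hX i; rewrite !coefD; apply: phom_add. Qed.

Lemma pgraph_mul g h g' h' :
  poly_graph X g g' -> poly_graph X h h' -> poly_graph X (g * h) (g' * h').
Proof.
by move=> gX hX i; rewrite !coefM; apply: phom_sum => j; apply: phom_mul.
Qed.

Lemma pgraphC x x' : X (x, x') -> poly_graph X x%:P x'%:P.
Proof. by move=> Xx i; rewrite !coefC; case: eqP => // _; apply: phom0. Qed.

Lemma pgraphX : poly_graph X 'X 'X.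
Proof. by rewrite -(map_polyX iota); apply: pgraph_base. Qed.

Lemma pgraphXn n : poly_graph X 'X^n 'X^n.
Proof. by rewrite -(map_polyXn iota); apply: pgraph_base. Qed.

Lemma pgraph_horner g g' x x' :
  poly_graph X g g' -> X (x, x') -> X (g.[x], g'.[x']).
Proof.
move=> gX Xx; pose n := maxn (size g) (size g').
rewrite (horner_coef_wide _ (leq_maxl _ _ : size g <= n)%N).
rewrite (horner_coef_wide _ (leq_maxr _ _ : size g' <= n)%N).
by apply: phom_sum => i; apply: phom_mul => //; apply: phom_exp.
Qed.

(** Algebraicity over K makes the domain a field. Write the irreducible polynomial of [x] as
    [q = X r + q_0]; here [q_0] is nonzero, since otherwise [q] would be associated to X and [x]
    would vanish. The inverse of any root [z] is then [- r(z) / q_0], and both [x] and [x'] are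
    roots. *)
Lemma phom_inv x x' : X (x, x') -> x != 0 -> X (x^-1, x'^-1) /\ x' != 0.
Proof.
move=> Xx x0; have [q [qmon [qsz qirr] qx _]] := sc_separable x.
have q00 : q`_0 != 0.
  apply: contra_neq x0 => q00; have Xq : 'X %| q.
    by rewrite -['X]subr0 dvdp_XsubCl /root horner_coef0 q00.
  have /eqp_root/(_ x) : map_poly iota 'X %= map_poly iota q.
    by rewrite eqp_map; apply: qirr => //; rewrite size_polyX.
  by rewrite qx map_polyX rootX => /eqP.
pose r := drop_poly 1 q.
have defq z : (map_poly iota q).[z] = (map_poly iota r).[z] * z + iota q`_0.
  rewrite -(poly_take_drop 1 q) -/r rmorphD rmorphM /= map_polyX hornerD
    hornerM hornerX.
  rewrite addrC expr1; congr (_ + _).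
  have -> : take_poly 1 q = (q`_0)%:P.
    by apply/polyP=> -[|i]; rewrite coef_take_poly coefC.
  by rewrite map_polyC hornerC coefD coefMX coefC addr0.
have qx' : (map_poly iota q).[x'] = 0.
  by apply: (phom_fun homX); rewrite -(eqP qx); apply: pgraph_horner => //;
    apply: pgraph_base.
have rE z : (map_poly iota q).[z] = 0 ->
  z != 0 /\ z^-1 = iota (- (q`_0)^-1) * (map_poly iota r).[z].
  rewrite defq => /eqP; rewrite addr_eq0 => /eqP rz.
  have iq0 : iota q`_0 != 0 by rewrite fmorph_eq0.
  have z0 : z != 0.
    by apply: contra_neq q00 => z0; apply: (fmorph_inj iota);
      rewrite rmorph0 -[LHS]opprK -rz z0 mulr0 oppr0.
  split=> //; apply: (mulIf z0);
    rewrite mulVf // -mulrA rz rmorphN fmorphV mulrNN mulVf //.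
have [x'0 x'V] := rE x' qx'; have [_ xV] := rE x (eqP qx).
split=> //; rewrite xV x'V; apply: phom_mul => //; first exact: phom_base.
by apply: pgraph_horner => //; apply: pgraph_base.
Qed.

Lemma phom_inj x : X (x, 0) -> x = 0.
Proof. by move=> Xx; apply/eqP/negPn/negP => /(phom_inv Xx)[_ /eqP]. Qed.

Lemma pgraph_size g g' : poly_graph X g g' -> size g = size g'.
Proof.
move=> gX; apply/eqP; rewrite eqn_leq; apply/andP; split;
  apply/leq_sizeP => j szj.
  by apply: phom_inj; have := gX j; rewrite (nth_default 0 szj).
by apply: (phom_fun homX); have := gX j; rewrite (nth_default 0 szj).
Qed.

(** Long division runs in parallel on both coordinates: corresponding polynomials have equal size,
    so each step cancels the same power of X. *)
Lemma pgraph_divp m m' : poly_graph X m m' -> m \is monic ->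
  forall g g', poly_graph X g g' ->
  exists q r q' r', [/\ poly_graph X q q', poly_graph X r r',
    g = q * m + r, g' = q' * m' + r' & (size r < size m)%N].
Proof.
move=> mX mmon g; have m0 : m != 0 by rewrite monic_neq0.
have [n] := ubnP (size g); elim: n g => // n IHn g /ltnSE szg g' gX.
have [ltgm|lemg] := ltnP (size g) (size m).
  exists 0, g, 0, g'; split=> //; rewrite ?mul0r ?add0r //.
  by rewrite -polyC0; apply: pgraphC; exact: phom0.
have g0 : g != 0.
  by apply: contraTneq lemg => ->; rewrite size_poly0 leqNgt size_poly_gt0 m0.
have szgg := pgraph_size gX.
pose c := (lead_coef g)%:P * 'X^(size g - size m).
pose c' := (lead_coef g')%:P * 'X^(size g - size m).
have cX : poly_graph X c c'.
  apply: pgraph_mul; last exact: pgraphXn.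
  by apply: pgraphC; rewrite /lead_coef -szgg; apply: gX.
have lg0 : lead_coef g != 0 by rewrite lead_coef_eq0.
have szc : size c = (size g - size m).+1.
  by rewrite /c mul_polyC size_scale // size_polyXn.
have szcm : size (c * m) = size g.
  by rewrite size_Mmonic ?szc -?size_poly_gt0 ?szc // addSn /= subnK.
have [|q [r [q' [r' [qX rX defg defg' szr]]]]] :=
    IHn (g - c * m) _ (g' - c' * m') (pgraph_sub gX (pgraph_mul cX mX)).
  apply: leq_trans szg; rewrite -[ltnRHS]prednK ?size_poly_gt0 // ltnS.
  apply/leq_sizeP => j; rewrite leq_eqVlt => /predU1P[<-|szj].
    rewrite coefB -/(lead_coef g) -[in X in _ - X]szcm -/(lead_coef _).
    by rewrite lead_coef_Mmonic // /c lead_coefM lead_coefC lead_coefXn mulr1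
      subrr.
  rewrite prednK ?size_poly_gt0 // in szj.
  by rewrite coefB !nth_default ?subrr ?szcm.
exists (q + c), r, (q' + c'), r'; split=> //; first exact: pgraph_add.
  by rewrite mulrDl addrAC -defg subrK.
by rewrite mulrDl addrAC -defg' subrK.
Qed.

(* [m] is the minimal polynomial of [y] over the domain of [X]. *)
Lemma phom_minpoly y : exists m m', [/\ poly_graph X m m',
  [/\ m \is monic, m' \is monic & size m = size m'], root m y,
  separable_poly m' &
  forall g g', poly_graph X g g' -> root g y -> m' %| g'].
Proof.
have [q [qmon _ qy qsep]] := sc_separable y.
pose P n := exists m m', [/\ poly_graph X m m', m \is monic, root m y &
  size m = n].
have exP : exists n, `[<P n>].
  exists (size q); apply/asboolP; exists (map_poly iota q), (map_poly iota q).
  by split; rewrite ?map_monic ?size_map_poly //; apply: pgraph_base.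
case: (ex_minnP exP) => n /asboolP[m [m' [mX mmon my szm]]] minn {exP}.
have szmm := pgraph_size mX.
have m'mon : m' \is monic.
  rewrite monicE; apply/eqP; apply: (phom_funE (x := 1)).
    by rewrite -(monicP mmon) /lead_coef -szmm; apply: mX.
  by have := phom_base homX 1; rewrite rmorph1.
have dvd g g' : poly_graph X g g' -> root g y -> m' %| g'.
  move=> gX gy; have [h [r [h' [r' [hX rX defg defg' szr]]]]] :=
    pgraph_divp mX mmon gX.
  have ry : root r y.
    by move: gy; rewrite defg /root hornerD hornerM (eqP my) mulr0 add0r.
  suff r0 : r = 0.
    have := pgraph_size rX; rewrite r0 size_poly0 => /esym/eqP.
    by rewrite size_poly_eq0 defg' => /eqP->; rewrite addr0 dvdp_mulIr.
  apply/eqP/negPn/negP => r0; have lr0 : lead_coef r != 0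
    by rewrite lead_coef_eq0.
  have szrr := pgraph_size rX.
  have [lrV _] : X ((lead_coef r)^-1, (lead_coef r')^-1) /\ lead_coef r' != 0.
    by apply: phom_inv => //; rewrite /lead_coef -szrr; apply: rX.
  suff /minn : `[<P (size r)>] by rewrite -szm leqNgt szr.
  apply/asboolP; exists ((lead_coef r)^-1%:P * r), ((lead_coef r')^-1%:P * r').
  split; first by apply: pgraph_mul => //; apply: pgraphC.
  - by rewrite monicE lead_coefM lead_coefC mulVf.
  - by rewrite rootM ry orbT.
  - by rewrite mul_polyC size_scale // invr_eq0.
exists m, m'; split=> //.
apply: (dvdp_separable (dvd _ _ (pgraph_base q) qy)).
by rewrite separable_map.
Qed.

(** The new graph consists of the pairs [(g(y), g'(y'))]. It is single-valued because [g(y) = 0]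
    forces [m'] to divide [g'], hence [g'(y') = 0]. *)
Lemma phom_adjoin y m m' y' : poly_graph X m m' -> root m' y' ->
    (forall g g', poly_graph X g g' -> root g y -> m' %| g') ->
  exists Y, [/\ partial_hom Y, X `<=` Y & Y (y, y')].
Proof.
move=> mX m'y' dvd.
exists [set z | exists g g', poly_graph X g g' /\ z = (g.[y], g'.[y'])].
split=> [|[x x'] Xx|]; last first.
- by exists 'X, 'X; rewrite !hornerX; split=> //; exact: pgraphX.
- by exists x%:P, x'%:P; rewrite !hornerC; split=> //; exact: pgraphC.
split=> [a|x1 x2 x1' x2'|x1 x2 x1' x2'|z].
- exists (map_poly iota a%:P), (map_poly iota a%:P); split;
    first exact: pgraph_base.
  by rewrite map_polyC !hornerC.
- move=> [g [g' [gX [-> ->]]]] [h [h' [hX [-> ->]]]].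
  by exists (g - h), (g' - h'); rewrite !hornerE; split=> //; exact: pgraph_sub.
- move=> [g [g' [gX [-> ->]]]] [h [h' [hX [-> ->]]]].
  by exists (g * h), (g' * h'); rewrite !hornerM; split=> //; exact: pgraph_mul.
- move=> [g [g' [gX [gy ->]]]].
  have /dvdpP[h ->] : m' %| g' by apply: dvd gX _; rewrite /root -gy.
  by rewrite hornerM (eqP m'y') mulr0.
Qed.

Lemma phom_ext y :
  exists Y, [/\ partial_hom Y, X `<=` Y & exists y', Y (y, y')].
Proof.
have [m [m' [mX [mmon m'mon szm] my m'sep dvd]]] := phom_minpoly y.
have [|y' m'y'] := sc_closed m'sep.
  by rewrite -szm; apply: root_size_gt1 my; rewrite monic_neq0.
have [Y [homY XY Yy]] := phom_adjoin mX m'y' dvd.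
by exists Y; split=> //; exists y'.
Qed.

Lemma phom_swap : partial_hom [set z | X (z.2, z.1)].
Proof.
split=> [a|x y x' y'|x y x' y'|y] /=.
- exact: phom_base.
- exact: phom_sub.
- exact: phom_mul.
- exact: phom_inj.
Qed.

End PartialHom.

(** Zorn's lemma gives a maximal graph containing [X]. By [phom_ext] it is defined everywhere; the
    same lemma applied to the inverse graph makes it onto. *)
Lemma phom_extend_gal X : partial_hom X ->
  exists s : gal Ksep, forall x y, X (x, y) -> s x = y.
Proof.
(* Joining [X] to every member makes the empty chain harmless: its union stands for [X] itself. *)
move=> homX; pose P (Y : set (Ksep * Ksep)) := partial_hom (X `|` Y).
have [F FP Ftot|Y [PY maxY]] := @Zorn_bigcup _ P.
  have in2 z t : (X `|` \bigcup_(Y in F) Y) z -> (X `|` \bigcup_(Y in F) Y) t ->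
      exists Y, [/\ partial_hom Y, Y z, Y t & Y `<=` X `|` \bigcup_(Y in F) Y].
    have sub Y : F Y -> X `|` Y `<=` X `|` \bigcup_(Y in F) Y.
      by move=> FY u [Xu|Yu]; [left|right; exists Y].
    move=> [Xz|[Y FY Yz]] [Xt|[Z FZ Zt]].
    - by exists X; split=> //; exact: subsetUl.
    - by exists (X `|` Z); split; [exact: FP|left|right|exact: sub].
    - by exists (X `|` Y); split; [exact: FP|right|left|exact: sub].
    - have [YZ|ZY] := Ftot Y Z FY FZ.
        by exists (X `|` Z); split; [exact: FP|right;
          exact: YZ|right|exact: sub].
      by exists (X `|` Y); split; [exact: FP|right|right; exact: ZY|exact: sub].
  split=> [a|x y x' y' /in2 h/h|x y x' y' /in2 h/h|y /[dup]/in2 h/h].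
  - by left; exact: phom_base.
  - by move=> [Y [homY Yx Yy]]; apply; exact: phom_sub.
  - by move=> [Y [homY Yx Yy]]; apply; exact: phom_mul.
  - by move=> [Y [homY Yy _ _]]; exact: phom_fun Yy.
pose Z := X `|` Y; have homZ : partial_hom Z by [].
have maxZ W : partial_hom W -> Z `<=` W -> W `<=` Z.
  move=> homW ZW; apply: contrapT => WZ; apply: (maxY W); last first.
    rewrite /P setUidr //; apply: subset_trans ZW; exact: subsetUl.
  split=> [|WY]; first by apply: subset_trans ZW; exact: subsetUr.
  by apply: WZ; apply: subset_trans WY _; exact: subsetUr.
have /choice[s sP] x : exists y, Z (x, y).
  have [W [homW ZW [y Wy]]] := phom_ext homZ x.
  by exists y; apply: (maxZ W).
have /choice[t tP] y : exists x, Z (x, y).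
  have [W [homW ZW [x Wx]]] := phom_ext (phom_swap homZ) y.
  exists x; apply: (maxZ [set z | W (z.2, z.1)]) => //; first exact: phom_swap.
  by move=> [u u'] Zu; apply: ZW.
have sE x y : Z (x, y) -> s x = y by apply: phom_funE.
have sauto : automorphism_over s.
  split=> [x y|||a]; last by apply: sE; exact: phom_base.
  - by apply: sE; exact: phom_sub.
  - split=> [|x y]; last by apply: sE; exact: phom_mul.
    by apply: sE; have := phom_base homZ 1; rewrite rmorph1.
  - exists t => x; last exact: sE.
    by apply: (phom_funE (phom_swap homZ) (x := s x)); [exact: tP|exact: sP].
by exists (mk_gal sauto) => x y Xxy; apply: sE; left.
Qed.

(** If the minimal polynomial [m] of [x] over K had degree above one, then by separability
    [m / (X - x)] would have a root [x'] different from [x], and sending [x] to [x'] would extend to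
    an automorphism moving [x]. *)
Lemma gal_fixed x : (forall s : gal Ksep, s x = x) -> exists a, x = iota a.
Proof.
move=> fixx; pose X := range (fun a => (iota a, iota a)).
have homX : partial_hom X.
  split=> [a|_ _ _ _ [a _ [<- <-]] [b _ [<- <-]]|_ _ _ _ [a _ [<- <-]] [b _ [<-
    <-]]|y].
  - by exists a.
  - by exists (a - b) => //; rewrite rmorphB.
  - by exists (a * b) => //; rewrite rmorphM.
  - by move=> [a _ [-> ->]].
have [m [m' [mX [mmon m'mon szm] mx m'sep dvd]]] := phom_minpoly homX x.
have defm : m' = m.
  by apply/polyP => i; have [a _ [<- <-]] := mX i.
move: mX szm m'sep dvd {m'mon}; rewrite {}defm => mX _ msep dvd.
have /factor_theorem[n defm] := mx.
have nmon : n \is monic by rewrite -(monicMr n (monicXsubC x)) -defm.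
have [szn|szn] := leqP (size n) 1.
  have n1 : n = 1.
    by move: nmon; rewrite (size1_polyC szn) monicE lead_coefC => /eqP->.
  have [a _ [ax _]] := mX 0; exists (- a); rewrite rmorphN ax.
  by rewrite defm n1 mul1r coefB coefX coefC sub0r opprK.
have nsep : separable_poly n by apply: dvdp_separable msep;
  rewrite defm dvdp_mulr.
have [x' nx'] := sc_closed nsep szn.
have mx' : root m x' by rewrite defm rootM nx'.
have [Y [homY XY Yx]] := phom_adjoin homX mX mx' dvd.
have [s sP] := phom_extend_gal homY.
have := sP _ _ Yx; rewrite fixx => xx'.
have : coprimep n ('X - x%:P) by apply: (separable_coprime msep); rewrite defm.
by rewrite coprimep_XsubC xx' nx'.
Qed.

End FixedField.

(** * Values of polynomials *)

Section OrderedAbelianGroup.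
Variable G : orderedAbelianGroup.
Implicit Types a b c : G.

Lemma oag_leD a b c d : a <= b -> c <= d -> a + c <= b + d.
Proof.
move=> ab cd; apply: le_trans (oag_le_add b _ _ cd).
by rewrite [a + c]addrC [b + c]addrC; apply: oag_le_add.
Qed.

Lemma oag_ltD a b c d : a < b -> c <= d -> a + c < b + d.
Proof.
rewrite [a < b]lt_neqAle => /andP[ab leab] cd;
  rewrite lt_neqAle oag_leD // andbT.
apply: contra_neq ab => abcd; apply/eqP; rewrite eq_le leab /=.
have -> : b = a + c - d by rewrite abcd addrK.
by rewrite -addrA -[leRHS]addr0 oag_le_add // -(subrr d) oag_leD.
Qed.

Lemma oag_leP a b : (a <= b) = ~~ (b < a).
Proof.
rewrite lt_neqAle; have := oag_total a b.
case: (eqVneq b a) => [->|ba] /=; first by rewrite lexx.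
case lab: (a <= b) => /=; last by move=> ->.
by move=> _; apply/esym/negP => lba; case/eqP: ba; apply: le_anti;
  rewrite lab lba.
Qed.

Lemma oag_ltP a b : (a < b) = ~~ (b <= a).
Proof. by rewrite oag_leP negbK. Qed.

Lemma oag_mulrn_le0 a m n : a <= 0 -> (m <= n)%N -> a *+ n <= a *+ m.
Proof.
move=> a0 /subnK<-; rewrite mulrnDr -[leRHS]add0r oag_leD //.
by elim: (n - m)%N => [|k IHk] //; rewrite mulrS -[leRHS]addr0 oag_leD.
Qed.

Lemma oag_mulrn_lt0 a m n : a < 0 -> (m < n)%N -> a *+ n < a *+ m.
Proof.
move=> a0 mn; apply: le_lt_trans (oag_mulrn_le0 (ltW a0) mn) _.
by rewrite mulrS -[ltRHS]add0r oag_ltD.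
Qed.

End OrderedAbelianGroup.

Section Valuation.
Variables (K : fieldType) (G : orderedAbelianGroup) (v : valuation K G).
Implicit Types (x y : K) (a b c : G).

Definition val_ge a x : bool := vle (Some a) (v x).
Definition val_gt a x : bool := ~~ vle (v x) (Some a).

Lemma val0 : v 0 = infty G.
Proof. exact/val_infty. Qed.

Lemma val1 : v 1 = Some 0.
Proof.
case v1: (v 1) => [a|]; last first.
  by have /eqP := (val_infty v 1).1 v1; rewrite oner_eq0.
have := Defs.valM v 1 1; rewrite mulr1 v1 /= => -[/esym/eqP].
by rewrite -subr_eq0 addrK => /eqP->.
Qed.

Lemma val_exp x a n : v x = Some a -> v (x ^+ n) = Some (a *+ n).
Proof.
move=> vx; elim: n => [|n IHn]; first exact: val1.
by rewrite exprS Defs.valM IHn vx /= mulrS.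
Qed.

Lemma valN x : v (- x) = v x.
Proof.
(* Twice [v (-1)] is [v 1 = 0], and an ordered group has no torsion. *)
have vN1 : v (-1) = Some 0.
  case vN1: (v (-1)) => [a|]; last first.
    by have /eqP := (val_infty v _).1 vN1; rewrite oppr_eq0 oner_eq0.
  have := Defs.valM v (-1) (-1); rewrite mulrNN mulr1 vN1 val1 /= => -[aa].
  congr Some; apply: le_anti; apply/andP; split; rewrite oag_leP;
    apply/negP => a0.
    by have := oag_ltD a0 (ltW a0); rewrite -aa addr0 ltxx.
  by have := oag_ltD a0 (ltW a0); rewrite -aa addr0 ltxx.
by rewrite -mulN1r Defs.valM vN1; case: (v x) => //= a; rewrite add0r.
Qed.

Lemma val_ge_le a b x : a <= b -> val_ge b x -> val_ge a x.
Proof. by rewrite /val_ge; case: (v x) => //= c; apply: le_trans. Qed.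

Lemma val_gt_lt a b x : a < b -> val_ge b x -> val_gt a x.
Proof.
rewrite /val_ge /val_gt; case: (v x) => //= c ab bc.
by rewrite -oag_ltP; apply: lt_le_trans bc.
Qed.

Lemma val_geM a b x y : val_ge a x -> val_ge b y -> val_ge (a + b) (x * y).
Proof.
by rewrite /val_ge Defs.valM; case: (v x) (v y) => [c|] [d|] //=;
  apply: oag_leD.
Qed.

Lemma val_geX a x n : val_ge a x -> val_ge (a *+ n) (x ^+ n).
Proof.
move=> ax; elim: n => [|n IHn]; first by rewrite /val_ge val1 /=.
by rewrite exprS mulrS val_geM.
Qed.

Lemma val_geD a x y : val_ge a x -> val_ge a y -> val_ge a (x + y).
Proof.
have := Defs.valD v x y; rewrite /val_ge /vmin; case: ifP => _.
  by case: (v x) (v (x + y)) => [b|] [c|] //= bc ab _; apply: le_trans bc.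
by case: (v y) (v (x + y)) => [b|] [c|] //= bc _ ab; apply: le_trans bc.
Qed.

Lemma val_gtD a x y : val_gt a x -> val_gt a y -> val_gt a (x + y).
Proof.
have := Defs.valD v x y; rewrite /val_gt /vmin; case: ifP => _.
  case: (v x) (v (x + y)) => [b|] [c|] //= bc ab _.
  by move: ab; rewrite -!oag_ltP => ab; apply: lt_le_trans bc.
case: (v y) (v (x + y)) => [b|] [c|] //= bc _ ab.
by move: ab; rewrite -!oag_ltP => ab; apply: lt_le_trans bc.
Qed.

Lemma val_ge0 a : val_ge a 0.
Proof. by rewrite /val_ge val0. Qed.

Lemma val_gt0 a : val_gt a 0.
Proof. by rewrite /val_gt val0. Qed.

Lemma val_gtN a x : val_gt a (- x) = val_gt a x.
Proof. by rewrite /val_gt valN. Qed.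

Lemma val_addl a x y : v x = Some a -> val_gt a y -> v (x + y) = Some a.
Proof.
move=> vx ay; have ge : val_ge a (x + y).
  apply: val_geD; first by rewrite /val_ge vx /=.
  by move: ay; rewrite /val_gt /val_ge; case: (v y) => //= b;
    rewrite -oag_ltP => /ltW.
have ngt : ~~ val_gt a (x + y).
  apply/negP => gt; have : val_gt a ((x + y) - y) by rewrite val_gtD ?val_gtN.
  by rewrite addrK /val_gt vx /= lexx.
move: ge ngt; rewrite /val_ge /val_gt; case: (v (x + y)) => //= b ab.
by rewrite negbK => ba; congr Some; apply: le_anti; rewrite ab ba.
Qed.

Lemma val_poly_bound (f : {poly K}) :
  exists2 c, c <= 0 & forall i, val_ge c f`_i.
Proof.
suff [c c0 cP] : exists2 c, c <= 0 & all (val_ge c) f.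
  exists c => // i; have [szi|szi] := ltnP i (size f);
    last by rewrite nth_default ?val_ge0.
  by move/all_nthP: cP; apply.
elim: (f : seq K) => [|x s [c c0 cP]]; first by exists 0.
have [d d0 [dc dx]] : exists2 d, d <= 0 & d <= c /\ val_ge d x.
  rewrite /val_ge; case: (v x) => [a|]; last by exists c.
  have [ac|ca] := orP (oag_total c a); first by exists c.
  by exists a; [apply: le_trans ca c0|rewrite /= lexx].
exists d => //=; rewrite dx /=; apply: sub_all cP => y; exact: val_ge_le.
Qed.

(* At arguments of very negative value the leading term of a monic polynomial
   dominates, so the value is [d] times that of the argument; elsewhere the
   values of the polynomial are bounded below. *)
Lemma val_horner_monic (f : {poly K}) d : f \is monic -> size f = d.+1 ->
  exists2 c, c <= 0 &
    forall x, val_ge c f.[x] \/ exists a, v f.[x] = Some (a *+ d).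
Proof.
move=> fmon szf; have [c c0 cP] := val_poly_bound f.
have cd0 : c *+ d <= 0 by have := oag_mulrn_le0 c0 (leq0n d); rewrite mulr0n.
(* When [x] has value at least [c], the term of degree [i <= d] has value at least [c + i c], and
   [c + i c >= c + d c] because [c <= 0]. *)
exists (c + c *+ d) => [|x]; first by rewrite -[leRHS]addr0 oag_leD.
have [ge|ngt] := boolP (val_ge c x).
  left; rewrite horner_coef; apply: (big_ind (val_ge _)).
  - exact: val_ge0.
  - exact: val_geD.
  move=> i _; apply: (@val_ge_le _ (c + c *+ i));
    last by rewrite val_geM ?val_geX.
  by rewrite oag_leD // oag_mulrn_le0 // -ltnS -szf.
right; move: ngt; rewrite /val_ge; case vx: (v x) => [a|] //=;
  rewrite -oag_ltP => ac.
exists a; rewrite horner_coef szf big_ord_recr /= addrC.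
have -> : f`_d = 1 by move/monicP: fmon; rewrite /lead_coef szf.
rewrite mul1r; apply: val_addl; first exact: val_exp.
have a0 : a <= 0 by apply: le_trans c0; apply: ltW.
apply: (big_ind (val_gt _)); [exact: val_gt0|exact: val_gtD|move=> i _].
(* Since [a < c] and [a <= 0], the term of degree [i < d] has value at least
   [c + i a > (i + 1) a >= d a]. *)
apply: (@val_gt_lt _ (c + a *+ i)).
  apply: le_lt_trans (oag_mulrn_le0 a0 (ltn_ord i)) _.
  by rewrite mulrS oag_ltD.
by rewrite val_geM // val_geX // /val_ge vx /=.
Qed.

(** A value of [f] below the bound [c] is a multiple of [d], hence of [p]. The [k i] are given
    distinct values in a class [b + p G] with [b] outside [p G]; their differences then have values
    in that class too, all below [c]. *)
Lemma monic_values_infinite_index p (f : {poly K}) d : (0 < p)%N ->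
    ~ divisible_by p G -> f \is monic -> size f = d.+1 -> (p %| d)%N ->
  exists k : nat -> K, forall i j x, i != j -> f.[x] != k i - k j.
Proof.
move=> p0 ndiv fmon szf /dvdnP[e de]; have [c c0 cP] :=
  val_horner_monic fmon szf.
have [b bp b0] : exists2 b : G, (forall a, a *+ p <> b) & b < 0.
  have [b bp] : exists b : G, forall a, a *+ p <> b.
    apply: contrapT => /forallNP nb; apply: ndiv; apply/seteqP; split=> // b _.
    by have /existsNP[a /contrapT ab] := nb b; exists a.
  have bn0 : b != 0 by apply/negP => /eqP b0; apply: (bp 0); rewrite mul0rn b0.
  have [b0|b0] := orP (oag_total b 0); first by exists b;
    rewrite // lt_neqAle bn0.
  exists (- b) => [a ab|].
    by apply: (bp (- a)); rewrite mulNrn ab opprK.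
  rewrite lt_neqAle oppr_eq0 bn0 /=.
  by have := oag_le_add (- b) _ _ b0; rewrite addr0 addNr.
(* As [c <= 0] and [b < 0], this sequence decreases strictly; the shift to [i + 1] puts already its
   first term below [c]. *)
pose g i := b + (c + b) *+ (p * i.+1).
have cb0 : c + b < 0 by rewrite addrC -[ltRHS]addr0 oag_ltD.
have gdec i j : (i < j)%N -> g j < g i.
  by move=> ij; rewrite /g ![b + _]addrC oag_ltD // oag_mulrn_lt0 // ltn_pmul2l.
have /choice[k kP] i : exists x, v x = Some (g i) by apply: val_onto.
have vk i j : i != j -> exists l, v (k i - k j) = Some (g l).
  have aux i' j' : (i' < j')%N -> v (k j' - k i') = Some (g j').
    move=> ij; apply: val_addl => //; rewrite val_gtN /val_gt kP /= -oag_ltP;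
      exact: gdec.
  rewrite neq_ltn => /orP[ij|ij]; last by exists i; apply: aux.
  by exists j; rewrite -valN opprB; apply: aux.
exists k => i j x ij; apply/eqP => fx; have [l vl] := vk i j ij;
  rewrite -fx in vl.
have [|[a va]] := cP x.
  rewrite /val_ge vl /= oag_leP => /negP[].
  have le1 : (c + b) *+ (p * l.+1) <= c + b.
    by apply: (@oag_mulrn_le0 _ _ 1); [exact: ltW|rewrite muln_gt0 p0].
  apply: lt_le_trans (oag_ltD b0 le1) _.
  by rewrite add0r -[leRHS]addr0 oag_leD // ltW.
move: va; rewrite vl => -[ga]; apply: (bp (a *+ e - (c + b) *+ l.+1)).
by rewrite mulrnBl -!mulrnA -de -ga /g [(l.+1 * p)%N]mulnC addrK.
Qed.

End Valuation.

(** * Linear independence of characters *)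

Lemma dedekind_independence (F : fieldType) (S : set F) (I : eqType)
    (c : I -> F -> F) (r : seq I) (a : I -> F) :
    S 1 -> (forall x y, S x -> S y -> S (x * y)) ->
    (forall i, c i 1 = 1) ->
    (forall i x y, S x -> S y -> c i (x * y) = c i x * c i y) ->
    {in r &, forall i j, i != j -> exists2 x, S x & c i x != c j x} ->
    uniq r -> (forall x, S x -> \sum_(i <- r) a i * c i x = 0) ->
  {in r, forall i, a i = 0}.
Proof.
move=> S1 SM c1 cM; elim: r a => [|i r IHr] a // dist /= /andP[ir ur] sum0.
have distr : {in r &, forall i j, i != j -> exists2 x, S x & c i x != c j x}.
  by move=> j k jr kr; apply: dist; rewrite inE ?jr ?kr orbT.
have ar j : j \in r -> a j = 0.
  move=> jr; have ij : i != j by apply: contraNneq ir => ->.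
  have [||y Sy] := dist i j _ _ ij;
    rewrite ?inE ?eqxx ?jr ?orbT // eq_sym -subr_eq0 => cy.
  (* Subtracting [c i y] times the relation at [x] from the relation at [y * x] eliminates the
     character [c i]. *)
  suff /(_ j jr)/eqP : {in r, forall k, a k * (c k y - c i y) = 0}.
    by rewrite mulf_eq0 (negPf cy) orbF => /eqP.
  apply: IHr distr ur _ => x Sx.
  have := sum0 _ (SM _ _ Sy Sx); have := sum0 _ Sx; rewrite !big_cons.
  move=> /(congr1 (fun z => c i y * z)); rewrite mulr0 => e1 e2.
  have := congr2 (fun z t => z - t) e2 e1; rewrite subrr.
  rewrite mulrDr cM // mulrCA opprD addrACA subrr add0r => sumE;
    rewrite -[RHS]sumE.
  rewrite mulr_sumr -sumrB; apply: eq_bigr => k _; rewrite cM //.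
  by rewrite mulrBr mulrBl -!mulrA [c i y * (a k * _)]mulrCA.
move=> j; rewrite inE => /predU1P[->|/ar//].
have := sum0 _ S1; rewrite big_cons c1 mulr1 big1_seq ?addr0 // => k /= kr.
by rewrite ar ?mul0r.
Qed.

(** * Additive polynomials *)

Section AdditivePolynomial.
Variables (F : fieldType) (A : seq F).
Hypotheses (uA : uniq A) (A0 : 0 \in A).
Hypothesis AB : {in A &, forall a b, a - b \in A}.

Let f := \prod_(a <- A) ('X - a%:P).

Lemma poly_of_roots_eq0 (g : {poly F}) :
  (size g <= size A)%N -> {in A, forall a, g.[a] = 0} -> g = 0.
Proof.
move=> szg gA; apply/eqP/negPn/negP => g0.
have := max_poly_roots g0 (rs := A); rewrite ltnNge szg => H;
  apply/notF/H => //.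
by apply/allP => a /gA/eqP.
Qed.

Lemma size_subgroup_gt0 : (0 < size A)%N.
Proof. by rewrite lt0n size_eq0; apply: contraTneq A0 => ->. Qed.

Lemma subgroup_poly_invariant a x : a \in A -> f.[x - a] = f.[x].
Proof.
move=> Aa; have AN b : b \in A -> - b \in A by move=> Ab; rewrite -sub0r AB.
have perm : perm_eq [seq b + a | b <- A] A.
  apply: uniq_perm => //; first by rewrite map_inj_uniq //; apply: addIr.
  move=> b; apply/mapP/idP => [[c Ac ->]|Ab]; first by rewrite -[a]opprK AB ?AN.
  by exists (b - a); rewrite ?AB ?subrK.
rewrite /f !horner_prod -[RHS](perm_big _ perm) big_map /=.
by apply: eq_bigr => b _; rewrite !hornerXsubC opprD addrA addrAC.
Qed.

(** The difference of the two sides has degree below [|A|], since the leading terms cancel, and it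
    vanishes on all of [A] because [f] is invariant under translation by [A]. *)
Lemma subgroup_poly_comp z : f \Po ('X + z%:P) = f + f.[z]%:P.
Proof.
have szA := size_subgroup_gt0.
have szf : size f = (size A).+1 by rewrite size_prod_XsubC.
have szXz : size ('X + z%:P : {poly F}) = 2 by rewrite size_XaddC.
apply/eqP; rewrite -subr_eq0; apply/eqP/poly_of_roots_eq0 => [|a Aa].
  apply/leq_sizeP => j; rewrite leq_eqVlt => /predU1P[<-|szj].
    (* As [A] is nonempty, the constant [f(z)] does not reach the coefficient of index [|A|]. *)
    rewrite opprD addrA coefB coefC -leqn0 leqNgt szA subr0 coefB.
    have -> : f`_(size A) = lead_coef f by rewrite /lead_coef szf.
    have -> : (f \Po ('X + z%:P))`_(size A) = lead_coef (f \Po ('X + z%:P)).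
      by rewrite /lead_coef size_comp_poly2 // szf.
    by rewrite lead_coef_comp ?szXz // lead_coefXaddC expr1n mulr1 subrr.
  rewrite coefB coefD coefC [j == 0]eqn0Ngt (leq_trans _ szj) // addr0.
  by rewrite !nth_default ?size_comp_poly2 ?szf ?subrr.
have fa : f.[a] = 0 by apply/eqP; rewrite -/(root f a) root_prod_XsubC.
rewrite hornerD hornerN hornerD hornerC horner_comp !hornerE fa add0r.
by rewrite -(subgroup_poly_invariant (a + z) Aa) [a + z]addrC addrK subrr.
Qed.

Lemma subgroup_polyD x y : f.[x + y] = f.[x] + f.[y].
Proof.
have := congr1 (horner^~ x) (subgroup_poly_comp y).
by rewrite horner_comp !hornerE.
Qed.

Lemma subgroup_polyN x : f.[- x] = - f.[x].
Proof.
have f0 : f.[0] = 0 by apply/eqP; rewrite -/(root f 0) root_prod_XsubC.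
by apply/eqP; rewrite -addr_eq0 -subgroup_polyD addNr f0.
Qed.

(** Differentiating [f(X + a) = f + f(a)] at 0 shows that [f'] takes the value [f'(0)] on all of
    [A]; its degree being below [|A|], it is constant. The constant is nonzero since [f] has
    distinct roots, and [f - c] has the same derivative. *)
Lemma subgroup_poly_separable c : separable_poly (f - c%:P).
Proof.
have szf : size f = (size A).+1 by rewrite size_prod_XsubC.
have deriv_const : f^`() = (f^`()).[0]%:P.
  apply/eqP; rewrite -subr_eq0; apply/eqP/poly_of_roots_eq0 => [|a Aa].
    apply: (leq_trans (size_polyD _ _)); rewrite size_polyN geq_max.
    rewrite (leq_trans (size_polyC_leq1 _)) ?size_subgroup_gt0 // andbT.
    by rewrite -ltnS -szf lt_size_deriv // -size_poly_gt0 szf.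
  have := congr1 (fun g => (g^`()).[0]) (subgroup_poly_comp a).
  rewrite deriv_comp !derivE hornerM horner_comp !hornerE => <-.
  by rewrite subrr.
rewrite separable_poly.unlock derivB derivC subr0.
have := separable_prod_XsubC A;
  rewrite uA separable_poly.unlock -/f deriv_const.
have [->|c0 _] := eqVneq (f^`()).[0] 0.
  by rewrite polyC0 coprimep0 -size_poly_eq1 szf eqSS size_eq0 => /eqP A';
    move: A0; rewrite A'.
rewrite -[(f^`()).[0]%:P]mulr1 mul_polyC coprimepZr //; exact: coprimep1.
Qed.

End AdditivePolynomial.

(** * Finite quotients of the absolute Galois group *)

Section FiniteQuotient.
Local Open Scope classical_set_scope.
Local Open Scope ring_scope.
Variables (K : fieldType) (Ksep : separable_closure K).
Local Notation iota := (sc_inj Ksep).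
Local Notation gal := (gal Ksep).

Lemma gal_poly_fixed (f : {poly Ksep}) : (forall s : gal, map_poly s f = f) ->
  exists f0, f = map_poly iota f0.
Proof.
move=> fixf; have /choice[a aP] j : exists a, f`_j = iota a.
  by apply: gal_fixed => s; rewrite -{2}(fixf s) coef_map.
exists (\poly_(j < size f) a j); apply/polyP => j.
rewrite coef_map /= coef_poly; case: ltnP => [_|szj]; first exact: aP.
by rewrite rmorph0 nth_default.
Qed.

Lemma gal_stable_seq (r : seq Ksep) :
  exists2 r' : seq Ksep, {subset r <= r'} &
    forall (s : gal) x, x \in r' -> s x \in r'.
Proof.
elim: r => [|x r [r' rr' r'P]]; first by exists [::].
have [o oP] := gal_conjugates x.
(* The list [o] may be larger than the orbit of [x]; the filter keeps exactly the conjugates. *)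
exists ([seq y <- o | `[<exists s : gal, s x = y>]] ++ r') => [y|s y].
  rewrite inE mem_cat => /predU1P[->|/rr'->]; rewrite ?orbT // mem_filter.
  apply/orP; left; apply/andP; split; last by have := oP 1%g.
  by apply/asboolP; exists 1%g.
rewrite !mem_cat !mem_filter => /orP[/andP[/asboolP[t <-] _]|yr];
  last by rewrite r'P ?orbT.
apply/orP; left; rewrite -galM oP andbT; apply/asboolP.
by exists (s * t)%g.
Qed.

(** Encodes Gal(N/K), for N generated over K by [gq_seq], as a finite set of classes with chosen
    representatives; products are computed in [gal]. *)
Record gal_quotient := GalQuotient {
  gq_seq : seq Ksep;
  gq_stable : forall (s : gal) x, x \in gq_seq -> s x \in gq_seq;
  gq_fin : finType;
  gq_pi : gal -> gq_fin;
  gq_repr : gq_fin -> gal;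
  gq_reprK : cancel gq_repr gq_pi;
  gq_eq : forall s t, gq_pi s = gq_pi t <-> {in gq_seq, s =1 t}
}.

(** On a Galois-stable finite list an automorphism acts as one of finitely many self-maps, and these
    maps serve as the classes. *)
Lemma gal_quotient_exists (r : seq Ksep) :
  exists Q : gal_quotient, {subset r <= gq_seq Q}.
Proof.
have [r' rr' r'P] := gal_stable_seq r.
pose T := {ffun seq_sub r' -> seq_sub r'}.
pose act (s : gal) : T := [ffun x => SeqSub (r'P s _ (ssvalP x))].
pose P (t : T) := `[<exists s, act s = t>].
have Pact s : P (act s) by apply/asboolP; exists s.
pose pi s : {t : T | P t} := exist _ (act s) (Pact s).
have /choice[rho rhoK] q : exists s, pi s = q.
  by have /asboolP[s sq] := valP q; exists s; apply: val_inj.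
have piP s t : pi s = pi t <-> {in r', s =1 t}.
  split=> [[/ffunP st] x xr|st]; last first.
    by apply/val_inj/ffunP => x; apply/val_inj; rewrite !ffunE /= st // ssvalP.
  by have := congr1 val (st (SeqSub xr)); rewrite !ffunE.
by exists (GalQuotient r'P rhoK piP).
Qed.

Variable Q : gal_quotient.
Local Notation pi := (@gq_pi Q).
Local Notation rho := (@gq_repr Q).

(* The fixed field of the kernel of [pi], a finite Galois extension of K. *)
Definition gq_field : set Ksep :=
  [set x | forall s t, pi s = pi t -> s x = t x].

Lemma gq_piM s s' t t' : pi s = pi s' -> pi t = pi t' ->
  pi (s * t)%g = pi (s' * t')%g.
Proof.
move=> /gq_eq ss /gq_eq tt; apply/gq_eq => x xr.
by rewrite !galM -tt // ss // gq_stable.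
Qed.

Lemma gq_repr_pi s : pi (rho (pi s)) = pi s.
Proof. exact: gq_reprK. Qed.

(** Left translation by [s] permutes the classes, with inverse the translation by [s^-1]. This is
    the invariance behind every trace and averaging argument below. *)
Lemma gq_sum_translate (F : gal -> Ksep) (s : gal) :
  (forall t u, pi t = pi u -> F t = F u) ->
  \sum_q F (s * rho q)%g = \sum_q F (rho q).
Proof.
move=> FP; have can2 (t u : gal) : (t * u)%g = 1%g ->
    cancel (fun q => pi (u * rho q)%g) (fun q => pi (t * rho q)%g).
  move=> tu q; rewrite -[RHS]gq_reprK.
  rewrite (gq_piM (t' := (u * rho q)%g) erefl) ?gq_repr_pi //.
  by rewrite mulgA tu mul1g.
have bij : {on [pred q | true], bijective (fun q => pi (s * rho q)%g)}.
  by apply: onW_bij; exists (fun q => pi (s^-1 * rho q)%g); apply: can2;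
    rewrite ?mulgV ?mulVg.
rewrite [RHS](reindex _ bij) /=; apply: eq_bigr => q _; apply: FP.
by rewrite gq_repr_pi.
Qed.

Lemma gqf_seq x : x \in gq_seq Q -> gq_field x.
Proof. by move=> xr s t /gq_eq; apply. Qed.

Lemma gqf_fixed x : (forall s : gal, s x = x) -> gq_field x.
Proof. by move=> fx s t _; rewrite !fx. Qed.

Lemma gqf_base a : gq_field (iota a).
Proof. by apply: gqf_fixed => s; rewrite gal_fix. Qed.

Lemma gqfB x y : gq_field x -> gq_field y -> gq_field (x - y).
Proof. by move=> Nx Ny s t st; rewrite !rmorphB /= (Nx s t) ?(Ny s t). Qed.

Lemma gqfM x y : gq_field x -> gq_field y -> gq_field (x * y).
Proof. by move=> Nx Ny s t st; rewrite !rmorphM /= (Nx s t) ?(Ny s t). Qed.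

(** Different classes already differ on [gq_seq], so they restrict to distinct characters of N. *)
Lemma gq_independence (a : gq_fin Q -> Ksep) q0 : a q0 != 0 ->
  exists2 x, gq_field x & \sum_q a q * rho q x != 0.
Proof.
move=> aq0; apply: contrapT => nox.
have /(_ q0 (mem_index_enum _))/eqP :
    {in index_enum (gq_fin Q), forall q, a q = 0}.
  apply: (@dedekind_independence Ksep gq_field _ (fun q x => rho q x)).
  - by rewrite -(rmorph1 iota); apply: gqf_base.
  - exact: gqfM.
  - by move=> q; rewrite rmorph1.
  - by move=> q x y _ _; rewrite rmorphM.
  - move=> q q' _ _ qq'; apply: contrapT => nodiff; case/eqP: qq'.
    rewrite -(gq_reprK q) -(gq_reprK q'); apply/gq_eq => x xr.
    apply/eqP/negPn/negP => xx; apply: nodiff; exists x => //; exact: gqf_seq.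
  - exact: index_enum_uniq.
  - by move=> x Nx; apply/eqP/negPn/negP => sx; apply: nox; exists x.
by rewrite (negPf aq0).
Qed.

(** By independence some [x] in N has nonzero trace; the trace is Galois-invariant, so dividing [x]
    by it normalizes the trace to one. *)
Lemma gq_trace_one : exists2 theta, gq_field theta & \sum_q rho q theta = 1.
Proof.
have [x Nx Tx] := @gq_independence (fun=> 1) (pi 1%g) (oner_neq0 _).
rewrite (eq_bigr (fun q => rho q x)) in Tx; last by move=> q _; rewrite mul1r.
have fixT (s : gal) : s (\sum_q rho q x) = \sum_q rho q x.
  by rewrite rmorph_sum /= -(gq_sum_translate (F := fun t => t x) s) // =>
    t u /Nx.
have fixTV (s : gal) : s (\sum_q rho q x)^-1 = (\sum_q rho q x)^-1.
  by rewrite fmorphV /= fixT.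
exists (x / \sum_q rho q x); first by apply: gqfM => //; exact: gqf_fixed.
rewrite (eq_bigr (fun q => rho q x / \sum_q rho q x)); last first.
  by move=> q _; rewrite rmorphM /= fixTV.
by rewrite -mulr_suml mulfV.
Qed.

Lemma gq_fixed (x : Ksep) : gq_field x -> (forall q, rho q x = x) ->
  exists a, x = iota a.
Proof.
by move=> Nx fixx; apply: gal_fixed => s; rewrite -(Nx _ _ (gq_repr_pi s)).
Qed.

End FiniteQuotient.

(** * Embedding problems with minimal kernel *)

Lemma homomorph1 (A B : groupType) (h : A -> B) :
  (forall x y, h (x * y)%g = (h x * h y)%g) -> h 1%g = 1%g.
Proof. by move=> hM; apply: (mulgI (h 1%g)); rewrite -hM !mulg1. Qed.

Lemma homomorphV (A B : groupType) (h : A -> B) :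
  (forall x y, h (x * y)%g = (h x * h y)%g) -> forall x, h x^-1%g = (h x)^-1%g.
Proof.
by move=> hM x; apply: (mulgI (h x)); rewrite -hM !mulgV homomorph1.
Qed.

(** The functional is a coordinate of [M] as a vector space over F_p, read in [F] through the
    embedding of the prime field. *)
Lemma abelem_functional (p : nat) (F : fieldType) (gT : finGroupType)
    (M : {group gT}) : p \in [pchar F] -> p.-abelem M -> M :!=: 1%g ->
  exists2 lam : gT -> F, {in M &, forall x y, lam (x * y)%g = lam x + lam y}
    & exists2 x, x \in M & lam x != 0.
Proof.
move=> pF abM ntM; have p_pr := pcharf_prime pF.
have [x Mx x1] : exists2 x, x \in M & x != 1%g.
  by apply/trivgPn.
pose rv := abelem_rV abM ntM.
have [j xj] : exists j, rv x 0 j != 0.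
  apply: contrapT => /forallNP noj; case/eqP: x1.
  apply: (@abelem_rV_inj p gT M abM ntM x 1%g Mx (group1 M));
    rewrite abelem_rV_1.
  by apply/rowP => j; rewrite mxE; apply/eqP/negPn/negP/noj.
exists (fun y => (rv y 0 j : nat)%:R) => [y z My Mz|].
  rewrite /rv abelem_rV_M // mxE /= -natrD.
  rewrite -[in RHS](GRing.natr_mod_pchar pF); congr (_%:R); congr (_ %% _)%N.
  exact: Fp_cast.
exists x => //; apply: contraNneq xj => xj0; apply/eqP/val_inj => /=.
have ltp : (rv x 0%R j < p)%N.
  by apply: leq_trans (ltn_ord _) _; rewrite Fp_cast.
move/eqP: xj0; rewrite -(dvdn_pcharf pF) => dvd.
by apply/eqP; apply: contraLR dvd; rewrite -lt0n => gt0; rewrite gtnNdvd.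
Qed.

(** Continuity of a homomorphism to a discrete group: it is trivial on a basic Krull neighbourhood
    of 1. The target thus carries no topology. *)
Definition open_kernel (K : fieldType) (Ksep : separable_closure K)
    (hT : groupType) (alpha : gal Ksep -> hT) : Prop :=
  exists r : seq Ksep, forall s : gal Ksep,
    {in r, forall x, s x = x} -> alpha s = 1%g.

Definition surjective_lift (K : fieldType) (Ksep : separable_closure K)
    (gT hT : groupType) (phi : gT -> hT) (alpha : gal Ksep -> hT)
    (beta : gal Ksep -> gT) : Prop :=
  [/\ forall s t, beta (s * t)%g = (beta s * beta t)%g,
      forall s, phi (beta s) = alpha s,
      forall g, exists s, beta s = g &
      open_kernel beta].

Section Embedding.
Variables (p : nat) (K : fieldType) (charK : p \in [pchar K]).
Variables (Ksep : separable_closure K).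
Local Notation iota := (sc_inj Ksep).
Local Notation gal := (gal Ksep).
Variables (gT : finGroupType) (hT : groupType).
Variables (phi : gT -> hT) (alpha : gal -> hT).
Hypothesis phiM : forall x y, phi (x * y)%g = (phi x * phi y)%g.
Hypothesis alphaM : forall s t, alpha (s * t)%g = (alpha s * alpha t)%g.
Hypothesis phi_onto : forall h, exists g, phi g = h.
Hypothesis alpha_onto : forall h, exists s, alpha s = h.
Variables (M : {group gT}).
Hypothesis kerphi : forall x, (x \in M) <-> phi x = 1%g.
Hypotheses (abM : p.-abelem M) (minM : minnormal M [set: gT]).
Variable Q : gal_quotient Ksep.
Hypothesis Qalpha : forall s t, gq_pi Q s = gq_pi Q t -> alpha s = alpha t.
Local Notation pi := (@gq_pi _ _ Q).
Local Notation rho := (@gq_repr _ _ Q).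
Local Notation N := (@gq_field _ _ Q).

(** Since [M] is abelian, conjugation on it depends only on the image in [hT]; through [alpha] this
    turns [M] into a Galois module. *)
Lemma conj_eq x g h : x \in M -> phi g = phi h -> (x ^ g)%g = (x ^ h)%g.
Proof.
move=> Mx gh; have Mgh : (g * h^-1)%g \in M.
  by apply/kerphi; rewrite phiM (homomorphV phiM) gh mulgV.
rewrite -[g](mulgKV h) conjgM; congr (_ ^ _)%g.
by apply/conjg_fixP/commgP; apply: (centsP (abelem_abelian abM)).
Qed.

Lemma memJM x g : x \in M -> (x ^ g)%g \in M.
Proof.
by move=> /kerphi x1; apply/kerphi;
  rewrite /conjg !phiM x1 mul1g (homomorphV phiM) mulVg.
Qed.

(** A functional [lam] on [M] is averaged over Gal(N/K) with weights the conjugates of some [l] in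
    N, which forces equivariance. The left action of [s] on [M] is [x ^ g^-1], with [g] any lift of
    [alpha s]. *)
Lemma equivariant_embedding : exists i : gT -> Ksep,
  [/\ {in M &, forall x y, i (x * y)%g = i x + i y},
      {in M, forall x, i x = 0 -> x = 1%g} &
      forall s g x, x \in M -> phi g = alpha s -> i (x ^ g^-1)%g = s (i x)].
Proof.
have /mingroupP[/andP[ntM nM] minM'] := minM.
have [lam lamM [x0 Mx0 lx0]] := abelem_functional charK abM ntM.
have /choice[w wP] s : exists g, phi g = alpha s by apply: phi_onto.
pose i l x := \sum_q iota (lam (x ^ w (rho q))%g) * rho q l.
have iM l : {in M &, forall x y, i l (x * y)%g = i l x + i l y}.
  move=> x y Mx My; rewrite -big_split; apply: eq_bigr => q _ /=.
  by rewrite conjMg lamM ?memJM // rmorphD /= mulrDl.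
have iG l s g x : N l -> x \in M -> phi g = alpha s ->
  i l (x ^ g^-1)%g = s (i l x).
  move=> Nl Mx gs; pose F (t : gal) := iota (lam ((x ^ g^-1) ^ w t)%g) * t l.
  transitivity (\sum_q F (rho q)) => //; rewrite -(gq_sum_translate s);
    last first.
    move=> t u tu; rewrite /F (Nl t u tu); congr (iota (lam _) * _).
    by apply: conj_eq; [exact: memJM|rewrite !wP; exact: Qalpha].
  rewrite rmorph_sum; apply: eq_bigr => q _; rewrite /F rmorphM /= gal_fix.
  congr (iota (lam _) * _); rewrite -conjgM; apply: conj_eq => //.
  by rewrite phiM (homomorphV phiM) gs !wP alphaM mulKg.
(* The coefficient at the class of 1 is [lam x0], which is nonzero, so independence provides [l]
   with [i l x0] nonzero. *)
have [|l Nl il] := @gq_independence _ _ Q (fun q =>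
  iota (lam (x0 ^ w (rho q))%g)) (pi 1%g).
  rewrite fmorph_eq0 (@conj_eq _ _ 1%g) ?conjg1 // wP (homomorph1 phiM)
    -(homomorph1 alphaM).
  by apply: Qalpha; rewrite gq_repr_pi.
(* By equivariance the kernel of [i l] on [M] is normalized by the whole group; it misses [x0], so
   minimality of [M] makes it trivial. *)
have gH : group_set [set x in M | i l x == 0].
  apply/group_setP; split=> [|x y].
    rewrite inE group1 /= -(addrK (i l 1%g) (i l 1%g)) -iM ?group1 //.
    by rewrite mulg1 subrr.
  rewrite !inE => /andP[Mx /eqP ix] /andP[My /eqP iy].
  by rewrite groupM // iM // ix iy addr0 eqxx.
exists (i l); split=> // [|s g x]; last exact: iG.
move=> x Mx ix; apply/eqP/negPn/negP => x1.
suff defH : Group gH = M :> {set gT}.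
  by move: Mx0; rewrite -defH inE => /andP[_ /eqP ix0]; case/eqP: il.
apply: minM'; last by apply/fintype.subsetP => y; rewrite inE => /andP[].
apply/andP; split; first by apply/trivgPn; exists x; rewrite // inE Mx ix eqxx.
apply/fintype.subsetP => g _; rewrite inE; apply/fintype.subsetP =>
  _ /imsetP[y /[!inE]/andP[My /eqP iy] ->].
rewrite memJM //=; have [s sg] := alpha_onto (phi g^-1).
by rewrite -[g]invgK (iG _ s) // iy rmorph0.
Qed.

(** * Additive cocycles and the lifts they define *)

Section Cohomology.
Variable i : gT -> Ksep.
Hypothesis iM : {in M &, forall x y, i (x * y)%g = i x + i y}.
Hypothesis i_ker : {in M, forall x, i x = 0 -> x = 1%g}.
Hypothesis iG : forall (s : gal) g x, x \in M -> phi g = alpha s ->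
  i (x ^ g^-1)%g = s (i x).

Let A := [seq i x | x <- enum M].

Lemma embed1 : i 1%g = 0.
Proof.
by apply: (addrI (i 1%g)); rewrite -iM ?group1 // mulg1 addr0.
Qed.

Lemma embedV : {in M, forall x, i x^-1 = - i x}.
Proof.
move=> x Mx; apply/eqP; rewrite -addr_eq0 -iM ?groupV //.
by rewrite mulVg embed1.
Qed.

Lemma embed_inj : {in M &, injective i}.
Proof.
move=> x y Mx My ixy; apply: (mulIg y^-1%g); rewrite mulgV.
by apply: i_ker; rewrite ?groupM ?groupV // iM ?groupV // embedV // ixy subrr.
Qed.

Lemma mem_imP a : reflect (exists2 x, x \in M & a = i x) (a \in A).
Proof.
apply: (iffP mapP) => -[x Mx ->]; exists x; rewrite ?mem_enum // in Mx *.
Qed.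

Lemma uniq_im : uniq A.
Proof.
by rewrite map_inj_in_uniq ?enum_uniq // => x y; rewrite !mem_enum;
  apply: embed_inj.
Qed.

Lemma im0 : 0 \in A.
Proof. by apply/mem_imP; exists 1%g; rewrite ?group1 ?embed1. Qed.

Lemma imB : {in A &, forall a b, a - b \in A}.
Proof.
move=> _ _ /mem_imP[x Mx ->] /mem_imP[y My ->]; apply/mem_imP.
by exists (x * y^-1)%g; rewrite ?groupM ?groupV // iM ?groupV // embedV.
Qed.

Lemma im_gal (s : gal) a : a \in A -> s a \in A.
Proof.
move=> /mem_imP[x Mx ->]; have [g gs] := phi_onto (alpha s).
by apply/mem_imP; exists (x ^ g^-1)%g; rewrite ?memJM ?(iG _ gs).
Qed.

Lemma size_im : size A = #|M|.
Proof. by rewrite size_map -cardE. Qed.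

(** The Galois group permutes the image of [M], so the coefficients of the product are fixed and
    descend to K. *)
Lemma im_poly_base :
  exists2 f : {poly K}, map_poly iota f = \prod_(a <- A) ('X - a%:P)
    & f \is monic /\ size f = #|M|.+1.
Proof.
have [f0 f0E] : exists f0, \prod_(a <- A) ('X - a%:P) = map_poly iota f0.
  apply: gal_poly_fixed => s; rewrite rmorph_prod /=.
  rewrite (eq_bigr (fun a => 'X - (s a)%:P)) => [|a _]; last first.
    by rewrite rmorphB /= map_polyX map_polyC.
  rewrite -(big_map s xpredT (fun a => 'X - a%:P)); apply: perm_big.
  have sA : {subset [seq s a | a <- A] <= A}.
    by move=> _ /mapP[a Aa ->]; apply: im_gal.
  have us : uniq [seq s a | a <- A].
    by rewrite map_inj_uniq ?uniq_im //; apply: fmorph_inj.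
  by have [] := uniq_min_size us sA; rewrite ?size_map // => _ ?;
    apply: uniq_perm => //; exact: uniq_im.
exists f0 => //; rewrite -(map_monic iota) -(size_map_poly iota) -f0E.
by rewrite monic_prod_XsubC size_prod_XsubC size_im.
Qed.

Variables (f : {poly K}).
Hypothesis fE : map_poly iota f = \prod_(a <- A) ('X - a%:P).
Local Notation F x := (map_poly iota f).[x].

Lemma imF_gal (s : gal) x : s (F x) = F (s x).
Proof.
rewrite -horner_map; congr _.[_]; apply/polyP => j.
by rewrite !coef_map /= gal_fix.
Qed.

Lemma imF_root x : reflect (exists2 m, m \in M & x = i m) (F x == 0).
Proof.
rewrite fE -/(root _ _) root_prod_XsubC; exact: mem_imP.
Qed.

Lemma imFD x y : F (x + y) = F x + F y.
Proof.
by rewrite fE subgroup_polyD //; [exact: uniq_im|exact: im0|exact: imB].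
Qed.

Lemma imFN x : F (- x) = - F x.
Proof.
by rewrite fE subgroup_polyN //; [exact: uniq_im|exact: im0|exact: imB].
Qed.

Lemma imF_surj c : exists y, F y = c.
Proof.
have := subgroup_poly_separable uniq_im im0 imB c;
  rewrite -fE => /sc_closed[|y].
  have szF : size (map_poly iota f) = #|M|.+1.
    by rewrite fE size_prod_XsubC size_im.
  rewrite size_polyDl szF ?ltnS ?cardG_gt0 // size_polyN.
  by apply: leq_trans (size_polyC_leq1 _) _; rewrite cardG_gt0.
by rewrite /root !hornerE subr_eq0 => /eqP; exists y.
Qed.

(* The factor set [w s * w t * (w (s t))^-1] of the extension splits over
   [N], where the trace is onto; the obstruction to splitting it over [M] is a
   1-cocycle with values in [N], which is again a coboundary. *)
Lemma weak_solutions : exists (a : Ksep) (w : gal -> gT) (e : gal -> Ksep),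
  [/\ forall s, phi (w s) = alpha s,
      forall s t,
        e (s * t)%g = e s + s (e t) + i (w s * w t * (w (s * t)%g)^-1)%g,
      forall s, pi s = pi 1%g -> e s = 0 /\ w s = 1%g &
      forall s, F (e s) = a - s a].
Proof.
have [theta Ntheta trtheta] := gq_trace_one Q.
have /choice[sec0 sec0K] : forall h, exists g, phi g = h by [].
(* Normalizing the section at 1 makes [w] trivial on the kernel of [alpha]. *)
have [sec secK sec1] : exists2 sec : hT -> gT, cancel sec phi & sec 1%g = 1%g.
  exists (fun h => (sec0 h * (sec0 1%g)^-1)%g) => [h|]; last exact: mulgV.
  by rewrite phiM (homomorphV phiM) !sec0K invg1 mulg1.
pose w s := sec (alpha s).
have wP s : phi (w s) = alpha s by exact: secK.
pose c (s t : gal) : gT := (w s * w t * (w (s * t)%g)^-1)%g.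
have cM s t : c s t \in M.
  by apply/kerphi; rewrite !phiM (homomorphV phiM) !wP alphaM mulgV.
have wpi s t : pi s = pi t -> w s = w t by move=> /Qalpha st; rewrite /w st.
have cpi s s' t t' : pi s = pi s' -> pi t = pi t' -> c s t = c s' t'.
  by move=> ss tt; rewrite /c (wpi _ _ ss) (wpi _ _ tt) (wpi _ _ (gq_piM ss
    tt)).
have cocycle s t u : i (c s t) + i (c (s * t)%g u) =
  s (i (c t u)) + i (c s (t * u)%g).
  rewrite -(iG (g := w s)) // -!iM ?memJM //; congr i.
  by rewrite /c /conjg invgK !mulgA !(mulgKV, mulgK).
(* Averaging the 2-cocycle in its second argument against [theta] splits it: applying the cocycle
   identity under the sum leaves [i (c s t)] times the trace of [theta], which is one. *)
pose e s := - \sum_q i (c s (rho q)) * (s * rho q)%g theta.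
have epi s t : pi s = pi t -> e s = e t.
  move=> st; congr (- _); apply: eq_bigr => q _.
  by rewrite (cpi _ _ _ _ st (erefl _)) (Ntheta _ _ (gq_piM st (erefl (pi (rho
    q))))).
have eM s t : e (s * t)%g = e s + s (e t) + i (c s t).
  have -> : e s = - \sum_q i (c s (t * rho q)%g) * (s * (t * rho q))%g theta.
    congr (- _); rewrite (gq_sum_translate (F := fun u =>
      i (c s u) * (s * u)%g theta)) //.
    move=> u u' uu; rewrite (cpi _ _ _ _ (erefl _) uu).
    by rewrite (Ntheta _ _ (gq_piM (erefl (pi s)) uu)).
  have -> : i (c s t) = \sum_q i (c s t) * (s * t * rho q)%g theta.
    rewrite -mulr_sumr (gq_sum_translate (F := fun u : gal => u theta)).
      by rewrite trtheta mulr1.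
    by move=> u u' /Ntheta.
  rewrite /e rmorphN rmorph_sum /= -!sumrN -!big_split /=;
    apply: eq_bigr => q _.
  rewrite rmorphM /= -!mulNr -!mulrDl; congr (_ * _).
  have := cocycle s t (rho q) => /eqP; rewrite addrC -subr_eq => /eqP <-.
  by rewrite opprB addKr opprD subrK.
have e1 s : pi s = pi 1%g -> e s = 0 /\ w s = 1%g.
  move=> s1; have w1 : w 1%g = 1%g by rewrite /w (homomorph1 alphaM).
  rewrite (epi _ _ s1) (wpi _ _ s1); split=> //.
  have e11 : e 1%g = e 1%g + e 1%g.
    by have := eM 1%g 1%g; rewrite /c !mulg1 w1 !mulg1 invg1 mulg1 embed1 addr0.
  by apply: (addrI (e 1%g)); rewrite addr0 -e11.
pose h s := F (e s).
(* [F] kills the image of [M], so the factor set disappears and [h] is a genuine 1-cocycle. *)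
have hM s t : h (s * t)%g = h s + s (h t).
  have ic0 : F (i (c s t)) = 0 by apply/eqP/imF_root; exists (c s t).
  by rewrite /h eM !imFD -imF_gal ic0 addr0.
(* Additive Hilbert 90: substituting the cocycle relation into [s a] gives [a - h s], again because
   [theta] has trace one. *)
pose a := \sum_q h (rho q) * rho q theta.
exists a, w, e; split=> // s.
have aE : a = \sum_q h (s * rho q)%g * (s * rho q)%g theta.
  rewrite (gq_sum_translate (F := fun u => h u * u theta)) // => t u tu.
  by rewrite /h (epi _ _ tu) (Ntheta _ _ tu).
rewrite {1}aE rmorph_sum -sumrB -[LHS]mulr1 -trtheta.
rewrite -(gq_sum_translate (F := fun u : gal => u theta) s) =>
  [|t u /Ntheta //].
rewrite mulr_sumr; apply: eq_bigr => q _.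
by rewrite rmorphM /= hM mulrDl; apply/esym; apply: addrK.
Qed.

(** Each [s y - y + e s] is a root of [f], hence [i (m s)] for some [m s] in [M], and [m s * w s] is
    multiplicative since [e] compensates the factor set. The image meets [M] in a subgroup normal in
    the whole group, as it surjects onto [hT] and [M] is abelian; once this intersection is
    nontrivial, minimality puts [M] inside the image. *)
Lemma solution_of_root (a y : Ksep) (k : K) (w : gal -> gT) (e : gal -> Ksep) :
    (forall s, phi (w s) = alpha s) ->
    (forall s t,
      e (s * t)%g = e s + s (e t) + i (w s * w t * (w (s * t)%g)^-1)%g) ->
    (forall s, pi s = pi 1%g -> e s = 0 /\ w s = 1%g) ->
    (forall s, F (e s) = a - s a) ->
    F y = a + iota k -> ~ N y ->
  exists beta : gal -> gT, surjective_lift phi alpha beta.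
Proof.
move=> wP eM e1 eF Fy Ny.
have /choice[m mP] (s : gal) : exists m, m \in M /\ i m = s y - y + e s.
  have /imF_root[m Mm iy] : F (s y - y + e s) == 0.
    by rewrite !imFD imFN -imF_gal Fy eF rmorphD /= gal_fix; apply/eqP; ring.
  by exists m.
have mM s : m s \in M by case: (mP s).
have im s : i (m s) = s y - y + e s by case: (mP s).
pose beta s := (m s * w s)%g.
have betaM s t : beta (s * t)%g = (beta s * beta t)%g.
  pose c := (w s * w t * (w (s * t)%g)^-1)%g.
  have Mc : c \in M by apply/kerphi;
    rewrite !phiM (homomorphV phiM) !wP alphaM mulgV.
  have -> : (beta s * beta t)%g = (m s * (m t ^ (w s)^-1) * c * w (s * t))%g.
    by rewrite /beta /c /conjg invgK !mulgA !mulgKV.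
  have Mj : (m t ^ (w s)^-1)%g \in M by apply: memJM.
  have Msj := groupM (mM s) Mj.
  congr (_ * _)%g; apply: (embed_inj (mM _) (groupM Msj Mc)).
  rewrite (iM Msj Mc) (iM (mM s) Mj) (iG (s :=
    s)) // !im eM rmorphD rmorphB /= -/c.
  by ring.
have betaP s : phi (beta s) = alpha s.
  by rewrite phiM wP; move/kerphi: (mM s) => ->; rewrite mul1g.
have ex g : exists2 s, phi g = phi (beta s) & (g * (beta s)^-1)%g \in M.
  have [s sg] := alpha_onto (phi g); exists s; rewrite ?betaP //.
  by apply/kerphi; rewrite phiM (homomorphV phiM) betaP sg mulgV.
have beta1 := homomorph1 betaM.
have m1 s : pi s = pi 1%g -> beta s = m s /\ i (m s) = s y - y.
  by move=> /e1[es ws]; rewrite im es addr0 /beta ws mulg1.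
pose B0 := [set g : gT | `[<exists s, beta s = g>]].
have B0P g : g \in B0 <-> exists s, beta s = g.
  by rewrite finset.in_set; split=> [/asboolP|?]; last exact/asboolP.
have gB : group_set B0.
  apply/group_setP; split=> [|g h]; first by apply/B0P; exists 1%g.
  by move=> /B0P[s <-] /B0P[t <-]; apply/B0P; exists (s * t)%g.
pose B := Group gB.
have inB s : beta s \in B by apply/B0P; exists s.
have /mingroupP[_ minM'] := minM.
have defD : (M :&: B)%G = M :> {set gT}.
  apply: minM'; last exact: subsetIl.
  apply/andP; split; last first.
    apply/fintype.subsetP => g _; rewrite inE;
      apply/fintype.subsetP => _ /imsetP[x /setIP[Mx Bx] ->].
    have [s sg _] := ex g; apply/setIP; split; first exact: memJM.
    by rewrite (conj_eq Mx sg) groupJ.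
  apply/trivgPn.
  (* As [y] is outside N, some [t^-1 * s] is trivial on N but moves [y]; there [e] and [w] are
     trivial, so its image is a nontrivial element of [M]. *)
  have [s [t [st syt]]] : exists s t, pi s = pi t /\ s y <> t y.
    apply: contrapT => nst; apply: Ny => s t st; apply: contrapT => syt.
    by apply: nst; exists s, t.
  have z1 : pi (t^-1 * s)%g = pi 1%g.
    by rewrite (gq_piM (erefl (pi t^-1%g)) st) mulVg.
  have [bz imz] := m1 _ z1; exists (beta (t^-1 * s)%g).
    by apply/setIP; split; rewrite // bz.
  apply/eqP => b1; have := imz; rewrite -bz b1 embed1 galM => /esym/eqP.
  rewrite subr_eq0 => /eqP tsy; apply: syt; rewrite -{2}tsy.
  by rewrite -galM mulgV.
exists beta; split=> // [g|].
  have [s _ Mg] := ex g; move: Mg; rewrite -defD => /setIP[_ Bg].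
  by apply/B0P; have := groupM Bg (inB s); rewrite mulgKV.
exists (y :: gq_seq Q) => s sr.
have s1 : pi s = pi 1%g by apply/gq_eq => x xr; rewrite sr // inE xr orbT.
have [-> ims] := m1 _ s1; apply: i_ker => //.
by rewrite ims sr ?mem_head // subrr.
Qed.

(** Were all the roots in N, pigeonhole would give two of them whose difference is Galois-invariant,
    hence in K; [f] maps this difference to [k n - k m], contrary to the choice of [k]. *)
Lemma root_not_in_gqf (a : Ksep) (k : nat -> K) :
    (forall n m x, n != m -> f.[x] != k n - k m) ->
  exists n y, F y = a + iota (k n) /\ ~ N y.
Proof.
move=> kP; have /choice[y yP] n : exists y, F y = a + iota (k n)
  by apply: imF_surj.
apply: contrapT => noy; have Ny n : N (y n).
  by apply: contrapT => Nn; apply: noy; exists n, (y n).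
(* Subtracting [y 0] removes [a]: now [F (z n)] lies in K, so [rho q (z n) - z n] is a root of [f],
   and the functions [t n] range over a finite set. *)
pose z n := y n - y 0%N.
have Nz n : N (z n) by apply: gqfB.
have /choice[t tP] n : exists t : {ffun gq_fin Q -> gT},
    forall q, i (t q) = rho q (z n) - z n.
  have /choice[t tP] q : exists x, i x = rho q (z n) - z n.
    have /imF_root[x Mx ->] : F (rho q (z n) - z n) == 0; last by exists x.
    rewrite imFD imFN -imF_gal /z imFD imFN !yP rmorphB !rmorphD /= !gal_fix.
    by apply/eqP; ring.
  by exists [ffun q => t q] => q; rewrite ffunE.
pose T := {ffun gq_fin Q -> gT}.
have [n [m [nm tnm]]] : exists n m : nat, n != m /\ t n = t m.
  apply: contrapT => noinj.
  have inj : injective (fun j : 'I_(#|T|.+1) => t j).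
    move=> j l tjl; apply/val_inj/eqP/negPn/negP => jl; apply: noinj.
    by exists j, l.
  by have := leq_card _ inj; rewrite card_ord ltnn.
have [x xE] : exists x, z n - z m = iota x.
  apply: (gq_fixed (Q := Q)); first exact: gqfB.
  move=> q; have := tP m q; rewrite -tnm tP => tnm'.
  by rewrite (rmorphB _ (z n) (z m)) /= -[rho q (z n)](subrK (z n)) tnm'; ring.
case/eqP: (kP n m x nm); apply: (fmorph_inj iota).
by rewrite -horner_map -xE /z rmorphB !imFD !imFN !imFD !imFN !yP /=; ring.
Qed.

End Cohomology.
End Embedding.

(** * Reduction to minimal kernels *)

Section Solve.
Variables (p : nat) (p_pr : prime p) (K : fieldType) (charK : p \in [pchar K]).
Variables (G : orderedAbelianGroup) (v : valuation K G).
Hypothesis ndiv : ~ divisible_by p G.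
Variable (Ksep : separable_closure K).
Local Notation gal := (gal Ksep).

Lemma surjective_lift_minimal (gT : finGroupType) (hT : groupType)
    (phi : gT -> hT) (alpha : gal -> hT) (M : {group gT}) :
    (forall x y, phi (x * y)%g = (phi x * phi y)%g) ->
    (forall s t, alpha (s * t)%g = (alpha s * alpha t)%g) ->
    (forall h, exists g, phi g = h) -> (forall h, exists s, alpha s = h) ->
    (forall x, x \in M <-> phi x = 1%g) -> p.-abelem M ->
    minnormal M [set: gT] ->
    open_kernel alpha ->
  exists beta, surjective_lift phi alpha beta.
Proof.
move=> phiM alphaM phi_onto alpha_onto kerphi abM minM [r rP].
have [Q rQ] := gal_quotient_exists r.
have Qalpha s t : gq_pi Q s = gq_pi Q t -> alpha s = alpha t.
  move=> /gq_eq st; suff : alpha (t^-1 * s)%g = 1%g.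
    by rewrite alphaM (homomorphV alphaM) => /(congr1 (fun h =>
      alpha t * h)%g); rewrite mulg1 mulKVg.
  by apply: rP => x /rQ xQ; rewrite galM st // -galM mulVg.
have [i [iM i_ker iG]] :=
  equivariant_embedding charK phiM alphaM phi_onto alpha_onto kerphi abM minM
    Qalpha.
have [f fE [fmon szf]] := im_poly_base phiM phi_onto kerphi iM i_ker iG.
have [a [w [e [wP eM e1 eF]]]] :=
  weak_solutions phiM alphaM phi_onto kerphi Qalpha iM i_ker iG fE.
(* The order of [M] is the degree of [f], so this is the divisibility needed for the values of
   [f]. *)
have pM : (p %| #|M|)%N.
  have /mingroupP[/andP[ntM _] _] := minM.
  by have [] := pgroup_pdiv (abelem_pgroup abM) ntM.
have [k kP] := monic_values_infinite_index v (prime_gt0 p_pr) ndiv fmon szf pM.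
have [n [y [Fy Ny]]] := root_not_in_gqf Q iM i_ker fE a (fun n m x => kP n m x).
exact: (solution_of_root phiM alphaM alpha_onto kerphi abM minM iM i_ker iG fE
  wP eM e1 eF Fy Ny).
Qed.

(** Induction on [|M|]: for a minimal normal [M0] inside [M], lift [alpha] to the quotient by [M0]
    first, then lift the result, again surjective with open kernel, through the quotient map, whose
    kernel is [M0]. *)
Lemma surjective_lift_pgroup (gT : finGroupType) (hT : groupType)
    (phi : gT -> hT) (alpha : gal -> hT) (M : {group gT}) :
    (forall x y, phi (x * y)%g = (phi x * phi y)%g) ->
    (forall s t, alpha (s * t)%g = (alpha s * alpha t)%g) ->
    (forall h, exists g, phi g = h) -> (forall h, exists s, alpha s = h) ->
    (forall x, x \in M <-> phi x = 1%g) -> p.-group M ->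
    open_kernel alpha ->
  exists beta, surjective_lift phi alpha beta.
Proof.
have [n] := ubnP #|M|; elim: n gT phi M => // n IHn gT phi M leMn.
move=> phiM alphaM phi_onto alpha_onto kerphi pM kalpha.
have [M1|ntM] := eqVneq (M : {set gT}) 1%g.
  have phi1 : phi 1%g = 1%g by apply/kerphi.
  have phi_inj : injective phi.
    move=> x y xy; apply: (mulIg y^-1%g); rewrite mulgV.
    apply/set1gP; rewrite -M1; apply/kerphi; rewrite phiM xy -phiM mulgV.
    exact: phi1.
  have /choice[w wP] s : exists g, phi g = alpha s by apply: phi_onto.
  exists w; split=> // [s t|g|].
  - by apply: phi_inj; rewrite phiM !wP alphaM.
  - by have [s sg] := alpha_onto (phi g); exists s; apply: phi_inj; rewrite wP.
  - by have [r rP] := kalpha; exists r => s /rP s1; apply: phi_inj;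
      rewrite wP s1 phi1.
have nM : [set: gT] \subset 'N(M).
  apply/fintype.subsetP => g _; rewrite finset.in_set;
    apply/fintype.subsetP => _ /imsetP[x Mx ->].
  exact: (memJM phiM kerphi).
have [M0 minM0 sM0M] := minnormal_exists ntM nM.
have [nM0 ntM0 abM0] := minnormal_solvable minM0 sM0M (pgroup_sol pM).
rewrite (is_abelem_pgroup (pgroupS sM0M pM)) in abM0.
have inN x : x \in 'N(M0) by apply: (fintype.subsetP nM0);
  rewrite finset.in_setT.
(* The factorization of [phi] through the quotient by [M0], evaluated on coset representatives. *)
pose psi (X : coset_of M0) := phi (repr X).
have psiE x : psi (coset M0 x) = phi x.
  have : repr (coset M0 x) \in coset M0 x by apply: mem_repr_coset.
  rewrite /psi; set g := repr _; rewrite val_coset // => /rcosetP[m Mm ->].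
  rewrite phiM; have /kerphi -> := fintype.subsetP sM0M _ Mm; exact: mul1g.
have coset_onto X : exists x, coset M0 x = X by exists (repr X);
  apply: coset_reprK.
have cosetM x y : coset M0 (x * y)%g = (coset M0 x * coset M0 y)%g
  by rewrite morphM.
have [|||||beta' [betaM betaP beta_onto kbeta]] :=
  IHn _ psi (M / M0)%G _ _ alphaM _ alpha_onto _ _ kalpha.
- by apply: leq_trans (ltn_quotient ntM0 sM0M) _; rewrite -ltnS.
- move=> X Y; have [x <-] := coset_onto X; have [y <-] := coset_onto Y.
  by rewrite -cosetM !psiE phiM.
- by move=> h; have [g <-] := phi_onto h; exists (coset M0 g).
- move=> X; have [x <-] := coset_onto X; rewrite psiE -kerphi;
    split=> [/morphimP[y _ My]|Mx].
    rewrite /= => /(congr1 psi); rewrite !psiE => xy.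
    by apply/kerphi; rewrite xy; apply/kerphi.
  exact: mem_quotient.
- exact: quotient_pgroup.
have [|beta [bM bP b_onto kb]] :=
  @surjective_lift_minimal _ _ (coset M0) beta' M0
  cosetM betaM coset_onto beta_onto _ abM0 minM0 kbeta.
  by move=> x; split=> [/coset_id//|/coset_idr]; apply.
by exists beta; split=> // s; rewrite -psiE bP betaP.
Qed.

End Solve.

(** * From profinite embedding problems to finite groups *)

Lemma finite_group_finGroupType (T : groupType) : finite_set [set: T]%classic ->
  exists (gT : finGroupType) (u : gT -> T) (u' : T -> gT),
    [/\ cancel u u', cancel u' u & forall x y, u (x * y)%g = (u x * u y)%g].
Proof.
move=> /finite_seqP[s sT].
have ins x : x \in s.
  by have : [set: T]%classic x by []; rewrite sT.
pose e x := index x s.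
have eK : pcancel e (fun n => if (n < size s)%N then Some (nth 1%g s n) else
  None).
  by move=> x; rewrite /e index_mem ins nth_index.
pose CT := PCanIsCountable eK.
have enumP : Finite.axiom (undup s).
  by move=> x; rewrite count_uniq_mem ?undup_uniq // mem_undup ins.
pose FT := isFinite.Build T enumP.
(* The carrier and the group law are kept, so both comparison maps are the identity. *)
pose gT : finGroupType := HB.pack (Group.sort T) CT FT.
by exists gT, id, id.
Qed.

(** The complement of a point is finite, hence closed. A finite profinite group is therefore
    discrete, which turns continuity of [alpha] into [open_kernel]. *)
Lemma finite_hausdorff_open1 (T : topologicalType) (x : T) :
  hausdorff_space T -> finite_set [set: T]%classic -> nbhs x [set x]%classic.
Proof.
move=> hT fT; apply: open_nbhs_nbhs; split=> //.
rewrite -[X in open X]setCK openC.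
have /accessible_finite_set_closed := hausdorff_accessible hT; apply.
by apply: sub_finite_set fT.
Qed.

Theorem theorem1p1 (p : nat) (p_prime : prime p)
  (K : fieldType) (charK : p \in [pchar K])
  (Gamma_v : orderedAbelianGroup) (v : valuation K Gamma_v)
  (not_divisible : ~ divisible_by p Gamma_v)
  (Ksep : separable_closure K)
  (E : embedding_problem (absolute_galois_group Ksep)) :
  finite_embedding_problem E -> p_embedding_problem E p ->
  properly_solvable E.
Proof.
case: E => Gam H alpha [alpha_cont alpha_onto] f [f_cont f_onto].
rewrite /finite_embedding_problem /p_embedding_problem /= => finG pker.
rewrite /properly_solvable /proper_solution /=.
have finH : finite_set [set: H]%classic.
  by rewrite -f_onto; apply: finite_image.
have alphaM (s t : gal Ksep) : alpha (s * t)%g = (alpha s * alpha t)%g.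
  exact: gmulfM.
have kalpha : open_kernel (alpha : gal Ksep -> H).
  have [r _ rP] := alpha_cont 1%g _ (finite_hausdorff_open1 _
    profinite_hausdorff finH).
  exists r => s sr; have := rP s; rewrite /= (homomorph1 alphaM); apply => x xr.
  by rewrite sr.
have [gT [u [u' [uK u'K uM]]]] := finite_group_finGroupType finG.
pose phi x := f (u x).
have phiM x y : phi (x * y)%g = (phi x * phi y)%g by rewrite /phi uM gmulfM.
have u1 := homomorph1 uM.
have gM : group_set [set x | phi x == 1%g].
  apply/group_setP; split=> [|x y]; rewrite !finset.in_set.
    by rewrite (homomorph1 phiM).
  by move=> /eqP phix /eqP phiy; rewrite phiM phix phiy mulg1.
have kerphi x : x \in Group gM <-> phi x = 1%g.
  by rewrite /= finset.in_set; split=> [/eqP|/eqP].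
have uX x n : u (x ^+ n)%g = (u x ^+ n)%g.
  by elim: n => [|n IHn]; rewrite ?expg0 // !expgS uM IHn.
have pM : p.-group (Group gM).
  (* The kernel is a p-group elementwise; Cauchy's theorem yields an element of each prime order [q]
     dividing its order, which forces [q = p]. *)
  apply/pgroupP => q q_pr /(Cauchy q_pr)[x Mx ox].
  have [n xn] := pker (u x) ((kerphi x).1 Mx).
  have : (x ^+ (p ^ n) = 1)%g.
    by apply: (can_inj uK); rewrite uX u1.
  move=> /eqP; rewrite -order_dvdn ox Euclid_dvdX // => /andP[qp _].
  by rewrite inE -(dvdn_prime2 q_pr p_prime).
have phi_onto h : exists g, phi g = h.
  have [x _ <-] : range f h by rewrite f_onto.
  by exists (u' x); rewrite /phi u'K.
have alpha_surj h : exists s, alpha s = h.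
  have [s _ <-] : range alpha h by rewrite alpha_onto.
  by exists s.
have [beta [betaM betaP beta_onto [r rP]]] :=
  surjective_lift_pgroup p_prime charK v not_divisible phiM alphaM
    phi_onto alpha_surj kerphi pM kalpha.
have ubM (s t : gal Ksep) : u (beta (s * t)%g) = (u (beta s) * u (beta t))%g.
  by rewrite betaM uM.
pose mixin := isMultiplicative.Build (gal Ksep) Gam (u \o beta) ubM.
pose ub : {multiplicative absolute_galois_group Ksep -> Gam} :=
  HB.pack (u \o beta) mixin.
exists ub; split; last by move=> s; exact: betaP.
split=> [s A /= As|].
  exists r => // t st; suff tE : beta t = beta s by rewrite /= tE;
    apply: nbhs_singleton.
  (* If [t] agrees with [s] on [r], then [s^-1 * t] fixes [r] and lies in the kernel of [beta]: the
     lift is locally constant. *)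
  rewrite -[t](mulKVg s) betaM (rP (s^-1 * t)%g) ?mulg1 // => x xr.
  by rewrite galM -st // -galM mulVg.
apply/seteqP; split=> // g _; have [s sg] := beta_onto (u' g).
by exists s; rewrite //= sg u'K.
Qed.
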